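(* Let $X$ be a standard Brownian motion, let $\lambda>0$, and let $T$ be an exponential random variable with parameter $\lambda$ (mean $1/\lambda$) independent of $X$. Then the distribution function of $(D^+_T,D^-_T)$ is given for $\alpha,\beta>0$ by $$\mathbf{P}(D^+_T<\alpha,\ D^-_T<\beta)=\begin{cases}u(\alpha,\beta),&\alpha\le\beta,\\ u(\beta,\alpha),&\alpha\ge\beta,\end{cases}$$ where $$u(\alpha,\beta):=1-\frac{1}{\cosh(\alpha\sqrt{2\lambda})}-v(\alpha,\beta)$$ and $$v(\alpha,\beta):=\frac{(\cosh(\alpha\sqrt{2\lambda})-1)\exp\left(-(\beta-\alpha)\sqrt{2\lambda}\,\coth(\alpha\sqrt{2\lambda})\right)}{\cosh(\alpha\sqrt{2\lambda})(\cosh(\alpha\sqrt{2\lambda})+1)}.$$ In particular, for $\alpha,\beta>0$, $$\mathbf{P}(D^+_T>\alpha,\ D^-_T<\beta)=v(\alpha\wedge\beta,\alpha\vee\beta).$$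
   Context: For $t\ge0$, the maximum increase and the maximum decrease of $X$ up to time $t$ are $D^+_t:=\sup_{0\le u\le v\le t}(X_v-X_u)$ and $D^-_t:=\sup_{0\le u\le v\le t}(X_u-X_v)$. The law of $(D^+_T,D^-_T)$ does not depend on the starting point of $X$, so the probability measure is written simply $\mathbf{P}$. Here $\alpha\wedge\beta=\min(\alpha,\beta)$ and $\alpha\vee\beta=\max(\alpha,\beta)$.
   Formalization: The ''in particular'' formula P(D⁺>α, D⁻<β)=v(α∧β, α∨β) is false for every α<β (the left side exceeds v by 1/cosh(α√(2λ))−1/cosh(β√(2λ))); it is proved for β≤α, and for α≤β for the event {D⁺<α, D⁻>β} instead. *)

(* Defs.v *)
From HB Require Import structures.
From mathcomp Require Import all_boot all_order all_algebra.
From mathcomp Require Import all_classical all_reals all_analysis.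
Set Implicit Arguments.
Unset Strict Implicit.
Unset Printing Implicit Defensive.
Import Order.TTheory GRing.Theory Num.Theory.
Import numFieldNormedType.Exports.
Local Open Scope classical_set_scope.
Local Open Scope ring_scope.

Section Independence.
Context {d : measure_display} {Omega : measurableType d} {R : realType}.
Variable P : probability Omega R.

(* Each B i may be the whole line, so the product rule for the full family
   contains the product rule for every subfamily. *)
Definition mutually_independent (n : nat) (Y : 'I_n -> Omega -> R) : Prop :=
  forall B : 'I_n -> set R, (forall i, measurable (B i)) ->
    P (\bigcap_i (Y i @^-1` B i)) = (\prod_(i < n) P (Y i @^-1` B i))%E.

Definition independent_systems (F G : set (set Omega)) : Prop :=
  forall A B, F A -> G B -> P (A `&` B) = (P A * P B)%E.

Definition process_sigma_algebra (X : R -> {RV P >-> R}) : set (set Omega) :=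
  <<s \bigcup_(t in `[0, +oo[) preimage_set_system setT (X t) measurable >>.

Definition independent_of_process (T : {RV P >-> R}) (X : R -> {RV P >-> R}) :=
  independent_systems (preimage_set_system setT T measurable)
                      (process_sigma_algebra X).

End Independence.

Section BrownianMotion.
Context {d : measure_display} {Omega : measurableType d} {R : realType}.
Variable P : probability Omega R.

(* Time is R, but only the values X t with 0 <= t are constrained (or used).
   The second parameter of normal_prob is the standard deviation. *)
Record standard_brownian_motion (x : R) (X : R -> {RV P >-> R}) : Prop := {
  brownian_start : forall w, X 0 w = x ;
  brownian_continuous :
    forall w, {within `[0, +oo[, continuous (fun t : R => X t w)} ;
  brownian_gaussian : forall s t : R, 0 <= s -> s < t ->
    forall B : set R, measurable B ->
      pushforward P (X t \- X s) B = normal_prob 0 (Num.sqrt (t - s)) B ;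
  brownian_independent : forall (n : nat) (t : nat -> R), 0 <= t 0%N ->
    {homo t : i j / (i <= j)%N >-> i <= j} ->
    mutually_independent P (fun i : 'I_n => X (t i.+1) \- X (t i))
}.

End BrownianMotion.

Section Extremes.
Context {R : realType}.
Implicit Types (f : R -> R) (t : R).

(* The supremum is taken in R: for t >= 0 and f continuous on [0, t] the set is
   nonempty and bounded. *)
Definition max_increase f t : R :=
  sup [set r | exists u v : R, [/\ 0 <= u, u <= v, v <= t & r = f v - f u]].

Definition max_decrease f t : R :=
  sup [set r | exists u v : R, [/\ 0 <= u, u <= v, v <= t & r = f u - f v]].

End Extremes.

Section Formulas.
Context {R : realType}.
Implicit Types (x lambda alpha beta : R).

Definition cosh x : R := (expR x + expR (- x)) / 2.
Definition sinh x : R := (expR x - expR (- x)) / 2.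
Definition coth x : R := cosh x / sinh x.

Definition v_fun lambda alpha beta : R :=
  let s := Num.sqrt (2 * lambda) in
  (cosh (alpha * s) - 1) * expR (- ((beta - alpha) * s * coth (alpha * s)))
  / (cosh (alpha * s) * (cosh (alpha * s) + 1)).

Definition u_fun lambda alpha beta : R :=
  1 - (cosh (alpha * Num.sqrt (2 * lambda)))^-1 - v_fun lambda alpha beta.

End Formulas.

(* Main.v *)
Require Import Defs.
From HB Require Import structures.
From mathcomp Require Import all_boot all_order all_algebra.
From mathcomp Require Import all_classical all_reals all_analysis.
From mathcomp Require Import measurable_realfun ring lra.
Import Order.TTheory GRing.Theory Num.Theory.
Import numFieldNormedType.Exports.
Local Open Scope classical_set_scope.
Local Open Scope ring_scope.

(* Sample X on a grid of mesh h, killed at rate lambda. The pair (a, b) =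
   (X - running minimum, running maximum - X) then moves by
   (a, b) |-> (max (a + x, 0), max (b - x, 0)) with a Gaussian increment x, and
   the event in question is that (a, b) stays in [0, alpha) x [0, beta) up to T.
   Put s = sqrt (2 lambda). Since exp (- lambda h) E[exp (s x)] =
   exp (- lambda h) E[exp (- s x)] = 1, a function of the form
   A(a + b) exp (s a) + B(a + b) exp (- s a) is preserved exactly by a step
   without reflection. The candidate g for the Laplace transform of the exit
   time is of this form, equals 1 on exit, and has zero derivative in the
   direction of reflection, so that reflecting costs an error quadratic in the
   increment of the running extremum; the sum of these errors is at most a
   constant times the largest increment times the final range. Hence the probability that the
   sampled path exits before T tends to g (0, 0) as h tends to 0. By continuity
   of the paths the limit lies between the probabilities of exceeding the
   levels strictly and weakly, and continuity of g (0, 0) in (alpha, beta)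
   shows that both agree. *)

(** * Hyperbolic functions *)

(** The number of steps grows as the mesh shrinks, so no error may be charged at a fixed price per
    step. Errors are charged to [potential] instead: it never decreases along the walk and is
    bounded, hence their sum telescopes whatever the number of steps. Leaving the domain, or passing
    from the narrow regime (range below [alpha]) to the wide one, costs an error linear in the
    increment; each happens at most once and is paid for by a jump of [potential] by at least 1. All
    this holds for increments up to [eta] only; larger ones are absorbed by an exponential moment
    with a free parameter [c]. The discount [p = exp (- lambda h)] has a double role: it centres
    both exponentials, and [p ^+ j] is the probability that [T] is at least [j h], so that a
    discounted sum over exit times is a probability. Only [alpha <= beta] is computed; the other
    order follows from [- X], which exchanges increase and decrease. *)

Section hyperbolic.
Context {R : realType}.
Implicit Types x y B d : R.

Lemma cosh0 : cosh 0 = 1 :> R.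
Proof. by rewrite /cosh oppr0 expR0; lra. Qed.

Lemma sinh0 : sinh 0 = 0 :> R.
Proof. by rewrite /sinh oppr0 expR0; lra. Qed.

Lemma coshN x : cosh (- x) = cosh x.
Proof. by rewrite /cosh opprK addrC. Qed.

Lemma sinhD x y : sinh (x + y) = sinh x * cosh y + cosh x * sinh y.
Proof. by rewrite /cosh /sinh opprD !expRD; field. Qed.

Lemma cosh2_sinh2 x : cosh x ^+ 2 = 1 + sinh x ^+ 2.
Proof.
have -> : cosh x ^+ 2 = expR x * expR (- x) + sinh x ^+ 2.
  by rewrite /cosh /sinh; field.
by rewrite -expRD subrr expR0.
Qed.

Lemma cosh_gt0 x : 0 < cosh x.
Proof. by rewrite /cosh divr_gt0// addr_gt0// expR_gt0. Qed.

Lemma cosh_ge1 x : 1 <= cosh x.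
Proof.
have := expR_ge1Dx x; have := expR_ge1Dx (- x).
by rewrite /cosh; lra.
Qed.

Lemma sinh_gt0 x : 0 < x -> 0 < sinh x.
Proof.
move=> x0; rewrite /sinh divr_gt0// subr_gt0 ltr_expR; lra.
Qed.

Lemma expR_lipschitz B x y : x <= B -> y <= B ->
  `|expR x - expR y| <= expR B * `|x - y|.
Proof.
wlog xy : x y / y <= x => [H xB yB|xB _].
  have [/H->//|/ltW/H] := leP y x.
  by rewrite distrC (distrC y); apply.
rewrite !ger0_norm ?subr_ge0 ?ler_expR//.
have -> : expR y = expR x * expR (y - x) by rewrite -expRD addrC subrK.
have := expR_ge1Dx (y - x); have := expR_gt0 x.
have : expR x <= expR B by rewrite ler_expR.
nra.
Qed.

(** Both signs rest on [expR x * (1 - x) <= 1]. For [x >= 0] it gives [expR x - 1 - x <= x * (expR x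
    - 1) <= x ^+ 2 * expR x]; for [x < 0] the claim is multiplied by [1 - x > 0]. *)
Lemma expR_taylor1 B x : `|x| <= B -> `|expR x - 1 - x| <= expR B * x ^+ 2.
Proof.
move=> xB; rewrite ger0_norm; last by have := expR_ge1Dx x; lra.
have xleB := le_trans (ler_norm x) xB.
have e1 : expR x * expR (- x) = 1 by rewrite -expRD subrr expR0.
have h1 := expR_ge1Dx (- x); have h0 := expR_gt0 x.
have hB : expR x <= expR B by rewrite ler_expR.
have hB1 : 1 <= expR B by rewrite -expR0 ler_expR; apply: le_trans xB.
have h2 := ler_wpM2l (ltW h0) h1; rewrite e1 in h2.
have h3 : 0 <= x ^+ 2 * (expR B - expR x) by rewrite mulr_ge0 ?sqr_ge0 ?subr_ge0.
have h4 : 0 <= x ^+ 2 * (expR B - 1) by rewrite mulr_ge0 ?sqr_ge0 ?subr_ge0.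
have [x0|x0] := leP 0 x.
  have : x * (expR x - 1) <= x * (x * expR x) by rewrite ler_wpM2l//; lra.
  lra.
have hp : 0 < 1 - x by lra.
have h5 : 0 <= - x * x ^+ 2 by rewrite mulr_ge0 ?sqr_ge0//; lra.
have : (1 - x) * (expR x - 1 - x) <= (1 - x) * x ^+ 2 by lra.
rewrite ler_pM2l//; lra.
Qed.

Lemma cosh_sub1_bound B x : `|x| <= B -> `|cosh x - 1| <= expR B * x ^+ 2.
Proof.
move=> xB; have := expR_taylor1 B x xB.
have := expR_taylor1 B (- x); rewrite normrN sqrrN => /(_ xB).
rewrite /cosh !ler_norml => /andP[] ? ? /andP[] ? ?; apply/andP; split; lra.
Qed.

Lemma sinh_sub_bound B x : `|x| <= B -> `|sinh x - x| <= expR B * x ^+ 2.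
Proof.
move=> xB; have := expR_taylor1 B x xB.
have := expR_taylor1 B (- x); rewrite normrN sqrrN => /(_ xB).
rewrite /sinh !ler_norml => /andP[] ? ? /andP[] ? ?; apply/andP; split; lra.
Qed.

Lemma cosh_lipschitz B x y : `|x| <= B -> `|y| <= B ->
  `|cosh x - cosh y| <= expR B * `|x - y|.
Proof.
rewrite (ler_norml x) (ler_norml y) => /andP[x1 x2] /andP[y1 y2].
have := expR_lipschitz B x y x2 y2.
have := expR_lipschitz B (- x) (- y).
have -> : - x - - y = - (x - y) by lra.
rewrite normrN !(lerNl _ B) => /(_ x1 y1); rewrite /cosh.
move: (expR B * `|x - y|) (expR x) (expR (- x)) (expR y) (expR (- y)).
move=> {x1 x2 y1 y2} z p p' q q'.
rewrite !ler_norml => /andP[] ? ? /andP[] ? ?; apply/andP; split; lra.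
Qed.

Lemma sinh_lipschitz B x y : `|x| <= B -> `|y| <= B ->
  `|sinh x - sinh y| <= expR B * `|x - y|.
Proof.
rewrite (ler_norml x) (ler_norml y) => /andP[x1 x2] /andP[y1 y2].
have := expR_lipschitz B x y x2 y2.
have := expR_lipschitz B (- x) (- y).
have -> : - x - - y = - (x - y) by lra.
rewrite normrN !(lerNl _ B) => /(_ x1 y1); rewrite /sinh.
move: (expR B * `|x - y|) (expR x) (expR (- x)) (expR y) (expR (- y)).
move=> {x1 x2 y1 y2} z p p' q q'.
rewrite !ler_norml => /andP[] ? ? /andP[] ? ?; apply/andP; split; lra.
Qed.

End hyperbolic.

(** * The Laplace transform of the exit time *)

Section profile.
Context {R : realType} (s alpha beta : R).
Implicit Types a b r x y d eta : R.

(* With a = X - running minimum and b = running maximum - X, the profile is the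
   Laplace transform of the exit time of (a, b) from [0, alpha) x [0, beta).
   Along a + b = r constant it solves g'' = s^2 g; reflection at the running
   minimum (resp. maximum) imposes a zero derivative in a at a = 0 (resp. in b
   at b = 0). As long as r < alpha this leaves the combinations of cosh (s a)
   and cosh (s b). Once r >= alpha only the level alpha for a and the reflection
   at a = 0 matter, and the coefficient of the second solution
   sinh (s (alpha - a)) grows exponentially in r at rate s coth (alpha s). *)
Definition rate_up := s * coth (alpha * s).

(** The factor in front is fixed by the value 1 at [a = 0], [b = beta], where the second level is
    reached. *)
Definition wide_coef r :=
  (1 - (cosh (alpha * s))^-1) * expR (- ((beta - r) * rate_up))
  / sinh (alpha * s).

(** Value of the wide profile at [a = 0], [b = alpha], where the two regimes meet. *)
Definition edge_value :=
  (cosh (alpha * s))^-1 + wide_coef alpha * sinh (alpha * s).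

(** The two narrow coefficients solve the linear system [profile_narrow alpha 0 = 1] and
    [profile_narrow 0 alpha = edge_value]; its determinant is [cosh ^+ 2 - 1 = sinh ^+ 2] at
    [alpha * s]. *)
Definition narrow_coef_down :=
  (cosh (alpha * s) * edge_value - 1) / sinh (alpha * s) ^+ 2.

Definition narrow_coef_up := (1 - narrow_coef_down) / cosh (alpha * s).

Definition profile_narrow a b :=
  narrow_coef_up * cosh (s * a) + narrow_coef_down * cosh (s * b).

Definition profile_wide a b :=
  cosh (s * a) / cosh (alpha * s) + wide_coef (a + b) * sinh (s * (alpha - a)).

Definition profile a b :=
  if a + b < alpha then profile_narrow a b else profile_wide a b.

Definition alive a b := (a < alpha) && (b < beta).

Definition stopped_profile a b := if alive a b then profile a b else 1.

(* A nondecreasing bounded functional of the walk: the errors of the successive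
   steps are estimated by its increments, so that their sum telescopes. *)
Definition potential a b :=
  if alive a b then a + b + (if alpha <= a + b then 1 else 0) else alpha + beta + 2.

Hypotheses (s0 : 0 < s) (alpha0 : 0 < alpha) (alpha_le_beta : alpha <= beta).

Let S := sinh (alpha * s).
Let C := cosh (alpha * s).

Let S0 : 0 < S. Proof. by rewrite sinh_gt0// mulr_gt0. Qed.
Let C0 : 0 < C. Proof. exact: cosh_gt0. Qed.
Let C1 : 1 <= C. Proof. exact: cosh_ge1. Qed.
Let CS : C ^+ 2 = 1 + S ^+ 2. Proof. exact: cosh2_sinh2. Qed.
Let CV1 : 0 <= 1 - C^-1.
Proof. by rewrite subr_ge0 invf_le1. Qed.

Lemma rate_up_ge0 : 0 <= rate_up.
Proof. exact: mulr_ge0 (ltW s0) (divr_ge0 (ltW C0) (ltW S0)). Qed.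

Lemma wide_coef_ge0 r : 0 <= wide_coef r.
Proof. exact: divr_ge0 (mulr_ge0 CV1 (expR_ge0 _)) (ltW S0). Qed.

Lemma wide_coefD r d : wide_coef (r + d) = wide_coef r * expR (d * rate_up).
Proof.
rewrite /wide_coef -/S -/C.
have -> : - ((beta - (r + d)) * rate_up) = - ((beta - r) * rate_up) + d * rate_up.
  by ring.
by rewrite expRD; ring.
Qed.

Lemma wide_coef_beta : wide_coef beta * S = 1 - C^-1.
Proof. by rewrite /wide_coef subrr mul0r oppr0 expR0 mulr1 mulfVK ?(gt_eqF S0). Qed.

Lemma profile_narrow_exit : profile_narrow alpha 0 = 1.
Proof.
rewrite /profile_narrow /narrow_coef_up mulr0 cosh0 (mulrC s) -/C divfK ?(gt_eqF C0)//.
by rewrite mulr1 subrK.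
Qed.

Lemma profile_narrow_edge : profile_narrow 0 alpha = edge_value.
Proof.
rewrite /profile_narrow mulr0 cosh0 (mulrC s) -/C mulr1 /narrow_coef_up.
rewrite /narrow_coef_down -/C -/S.
have SN0 : S != 0 by rewrite gt_eqF.
have CN0 : C != 0 by rewrite gt_eqF.
have -> : (1 - (C * edge_value - 1) / S ^+ 2) / C +
    (C * edge_value - 1) / S ^+ 2 * C =
    C^-1 + (C * edge_value - 1) * (C ^+ 2 - 1) / S ^+ 2 / C by field; exact/andP.
by rewrite CS addrAC subrr add0r; field; exact/andP.
Qed.

Lemma edge_value_le1 : edge_value <= 1.
Proof.
rewrite /edge_value -/C -/S addrC -lerBrDr -wide_coef_beta (ler_wpM2r (ltW S0))//.
have -> : wide_coef beta = wide_coef alpha * expR ((beta - alpha) * rate_up).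
  by rewrite -wide_coefD addrC subrK.
apply: ler_peMr; first exact: wide_coef_ge0.
rewrite -expR0 ler_expR; apply: mulr_ge0 rate_up_ge0.
by rewrite subr_ge0.
Qed.

(** For a step that jumps from the narrow regime over [beta]: this forces [beta - alpha] below the
    step size, so [edge_value], the nearby value of the profile, is close to the exit value 1. *)
Lemma edge_value_gap : 1 - edge_value <= rate_up * (beta - alpha).
Proof.
have -> : 1 - edge_value =
    (1 - C^-1) * (1 - expR (- ((beta - alpha) * rate_up))).
  by rewrite /edge_value /wide_coef -/C -/S mulfVK ?(gt_eqF S0)//; ring.
have := expR_ge1Dx (- ((beta - alpha) * rate_up)) => e1.
have g0 : 0 <= rate_up * (beta - alpha) by rewrite mulr_ge0 ?rate_up_ge0 ?subr_ge0.
have CVp : 0 <= C^-1 by rewrite invr_ge0 (ltW C0).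
apply: le_trans (_ : 1 - expR (- ((beta - alpha) * rate_up)) <= _); last by lra.
have : expR (- ((beta - alpha) * rate_up)) <= 1.
  by rewrite -expR0 ler_expR oppr_le0 mulrC.
by move=> e2; apply: ler_piMl; lra.
Qed.

(** Increments of size at most 1 keep every argument within distance 1 of [[0, beta]]. *)
Let B := beta + 2.

(** A single constant that is at least 1 serves in all estimates, so that products of bounds compare
    through powers of [L]. *)
Lemma profile_constants : exists2 L : R, 1 <= L &
  [/\ forall x y, `|x| <= B -> `|y| <= B ->
        `|cosh (s * x) - cosh (s * y)| <= L * `|x - y|,
      forall x y, `|x| <= B -> `|y| <= B ->
        `|sinh (s * x) - sinh (s * y)| <= L * `|x - y|,
      forall d, `|d| <= B -> `|cosh (s * d) - 1| <= L * d ^+ 2,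
      forall d, `|d| <= B -> `|sinh (s * d) - s * d| <= L * d ^+ 2 &
      forall d, `|d| <= B ->
        `|expR (d * rate_up) - 1 - d * rate_up| <= L * d ^+ 2] /\
  [/\ forall r, r <= B -> wide_coef r <= L,
      forall x y, `|x| <= B -> `|y| <= B ->
        `|wide_coef x - wide_coef y| <= L * `|x - y|,
      `|narrow_coef_up| <= L, `|narrow_coef_down| <= L &
      [/\ S <= L, C <= L & rate_up <= L]].
Proof.
have B0 : 0 <= B.
  have := le_trans (ltW alpha0) alpha_le_beta; rewrite /B; lra.
have g0 := rate_up_ge0.
have W0 : 0 <= wide_coef 0 by exact: wide_coef_ge0.
pose L1 := expR (s * B) * s; pose L2 := expR (s * B) * s ^+ 2.
pose L3 := expR (B * rate_up) * rate_up ^+ 2.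
pose L4 := wide_coef 0 * expR (B * rate_up).
pose L5 := wide_coef 0 * (expR (B * rate_up) * rate_up).
have L10 : 0 <= L1 by rewrite mulr_ge0 ?expR_ge0 ?(ltW s0).
have L20 : 0 <= L2 by rewrite mulr_ge0 ?expR_ge0 ?sqr_ge0.
have L30 : 0 <= L3 by rewrite mulr_ge0 ?expR_ge0 ?sqr_ge0.
have L40 : 0 <= L4 by rewrite mulr_ge0 ?expR_ge0.
have L50 : 0 <= L5 := mulr_ge0 W0 (mulr_ge0 (expR_ge0 _) g0).
have [S00 C00] := (ltW S0, ltW C0).
have n1 := normr_ge0 narrow_coef_up; have n2 := normr_ge0 narrow_coef_down.
pose L := 1 + L1 + L2 + L3 + L4 + L5 + `|narrow_coef_up| +
  `|narrow_coef_down| + S + C + rate_up.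
have sn x : `|x| <= B -> `|s * x| <= s * B.
  by move=> xB; rewrite normrM (ger0_norm (ltW s0)) ler_pM2l.
have gn x : `|x| <= B -> `|x * rate_up| <= B * rate_up.
  by move=> xB; rewrite normrM (ger0_norm g0) ler_wpM2r.
have wE x : wide_coef x = wide_coef 0 * expR (x * rate_up).
  by rewrite -[in LHS](add0r x) wide_coefD.
have up (K z w : R) : z <= K * w -> 0 <= w -> K <= L -> z <= L * w.
  by move=> h w0 KL; apply: (le_trans h); rewrite ler_wpM2r.
have [l1 l2 l3 l4 l5] : [/\ L1 <= L, L2 <= L, L3 <= L, L4 <= L & L5 <= L].
  by clear up wE; clearbody L1 L2 L3 L4 L5; rewrite /L; split; lra.
have [l0 l6 l7 [l8 l9 l10]] : [/\ 1 <= L, `|narrow_coef_up| <= L,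
    `|narrow_coef_down| <= L &
    [/\ S <= L, C <= L & rate_up <= L]].
  by clear up wE; clearbody L1 L2 L3 L4 L5; rewrite /L; split; [lra|lra|lra|split; lra].
exists L => //.
split; split.
- move=> x y xB yB; apply: (up L1) => //.
  apply: (le_trans (cosh_lipschitz _ _ _ (sn _ xB) (sn _ yB))).
  by rewrite -mulrBr normrM (ger0_norm (ltW s0)) mulrA.
- move=> x y xB yB; apply: (up L1) => //.
  apply: (le_trans (sinh_lipschitz _ _ _ (sn _ xB) (sn _ yB))).
  by rewrite -mulrBr normrM (ger0_norm (ltW s0)) mulrA.
- move=> d dB; apply: (up L2); rewrite ?sqr_ge0//.
  by apply: (le_trans (cosh_sub1_bound _ _ (sn _ dB))); rewrite exprMn mulrA.
- move=> d dB; apply: (up L2); rewrite ?sqr_ge0//.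
  by apply: (le_trans (sinh_sub_bound _ _ (sn _ dB))); rewrite exprMn mulrA.
- move=> d dB; apply: (up L3); rewrite ?sqr_ge0//.
  by apply: (le_trans (expR_taylor1 _ _ (gn _ dB))); rewrite exprMn mulrCA mulrC -mulrA.
- move=> r rB; apply: le_trans l4; rewrite wE /L4 ler_wpM2l// ler_expR ler_wpM2r//.
- move=> x y xB yB; apply: (up L5) => //; rewrite (wE x) (wE y) -mulrBr normrM (ger0_norm W0).
  rewrite /L5 -[leRHS]mulrA; apply: ler_wpM2l => //.
  apply: le_trans (expR_lipschitz (B * rate_up) _ _ _ _) _.
  + exact: le_trans (ler_norm _) (gn _ xB).
  + exact: le_trans (ler_norm _) (gn _ yB).
  + by rewrite -mulrBl normrM (ger0_norm g0) mulrCA mulrC -mulrA.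
- exact: l6.
- exact: l7.
- by split.
Qed.

End profile.

Lemma normr_mul_le {R : numDomainType} (x y p q : R) :
  `|x| <= p -> `|y| <= q -> `|x * y| <= p * q.
Proof. by move=> xp yq; rewrite normrM ler_pM. Qed.

Ltac lin L := repeat match goal with
  | H : context [L] |- _ => clear H
  | H : context [alive] |- _ => clear H
  | H : context [potential] |- _ => clear H
  | H : context [cosh] |- _ => clear H
  | H : context [sinh] |- _ => clear H
  | H : context [`|_|] |- _ => clear H
  end; lra.

(* Outside the exit and the passage from narrow to wide, which occur at most
   once each, the error is quadratic in the increment of the running extremum
   because the normal derivative of the profile vanishes there. *)
Lemma profile_step_error {R : realType} (s alpha beta : R) :
  0 < s -> 0 < alpha -> alpha <= beta -> exists2 K : R, 0 <= K & forall a b x eta,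
  0 <= a -> 0 <= b -> a < alpha -> b < beta -> a + b < beta ->
  eta <= 1 -> `|x| <= eta ->
  `|profile s alpha beta (a + x) (b - x) -
    stopped_profile s alpha beta (Num.max (a + x) 0) (Num.max (b - x) 0)|
  <= K * eta * (potential alpha beta (Num.max (a + x) 0) (Num.max (b - x) 0) -
                potential alpha beta a b).
Proof.
move=> s0 alpha0 alpha_le_beta.
pose S := sinh (alpha * s); pose C := cosh (alpha * s).
have [L L1 [[Lcosh Lsinh Lcosh1 Lsinh1 Lexp] [Lw Lw2 Lc1 Lc2 [LS LC Lr]]]] :=
  profile_constants s alpha beta s0 alpha0 alpha_le_beta.
(* The constant comes from reflection at the minimum in the wide regime, [L + L * (3 * L ^+ 2)];
   every other case needs at most [3 * L ^+ 2]. *)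
exists (4 * L ^+ 3); first by rewrite mulr_ge0// exprn_ge0//; lra.
have L0 : 0 <= L by lra.
have LL2 : L <= L ^+ 2 by rewrite expr2 ler_peMl.
have LL3 : L ^+ 2 <= L ^+ 3 by rewrite exprS ler_peMl// sqr_ge0.
have S0 : 0 < S by rewrite sinh_gt0// mulr_gt0.
have C0 : 0 < C by exact: cosh_gt0.
have C1 : 1 <= C by exact: cosh_ge1.
have SL : `|S| <= L by rewrite gtr0_norm.
have CL : `|C| <= L by rewrite gtr0_norm.
have CV : `|C^-1| <= 1 by rewrite ger0_norm ?invr_ge0 ?(ltW C0)// invf_le1.
have WL r : r <= beta + 2 -> `|wide_coef s alpha beta r| <= L.
  by move=> /Lw h; rewrite ger0_norm//; exact: wide_coef_ge0.
move=> a b x eta a0 b0 aalpha bbeta abbeta eta1 xeta.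
have eta0 : 0 <= eta := le_trans (normr_ge0 x) xeta.
move: (xeta); rewrite ler_norml => /andP[x1 x2].
have alive_ab : alive alpha beta a b by rewrite /alive aalpha.
(* A live potential is below [beta + 1], so exit raises it by more than 1 and an error linear in
   [eta] can be afforded. *)
have exit_gap a' b' : ~~ alive alpha beta a' b' ->
    1 <= potential alpha beta a' b' - potential alpha beta a b.
  rewrite /potential alive_ab => /negbTE ->; case: ifP => _; lin L.
have K1 (z p : R) : 0 <= p -> `|z| <= 4 * L ^+ 3 * eta -> 1 <= p ->
    `|z| <= 4 * L ^+ 3 * eta * p.
  move=> p0 h p1; apply: (le_trans h); apply: ler_peMr => //.
  by rewrite !mulr_ge0// exprn_ge0.
have weaken (z k : R) : k <= 4 -> `|z| <= k * L ^+ 2 * eta ->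
    `|z| <= 4 * L ^+ 3 * eta.
  move=> k4 h; apply: (le_trans h); apply: ler_wpM2r => //.
  apply: (@le_trans _ _ (4 * L ^+ 2)); first by rewrite ler_wpM2r ?sqr_ge0.
  by rewrite ler_wpM2l.
have [ae aeE] : exists ae, ae = a + x by exists (a + x).
have [be beE] : exists be, be = b - x by exists (b - x).
rewrite -aeE -beE; have abe : ae + be = a + b by rewrite aeE beE; ring.
have cc (y z e : R) : `|y| <= beta + 2 -> `|z| <= beta + 2 -> `|y - z| <= e ->
    `|cosh (s * y) - cosh (s * z)| <= L * e.
  by move=> yB zB yz; apply: (le_trans (Lcosh _ _ yB zB)); rewrite ler_wpM2l.
have ss' (y z e : R) : `|y| <= beta + 2 -> `|z| <= beta + 2 -> `|y - z| <= e ->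
    `|sinh (s * y) - sinh (s * z)| <= L * e.
  by move=> yB zB yz; apply: (le_trans (Lsinh _ _ yB zB)); rewrite ler_wpM2l.
have ww (y z e : R) : `|y| <= beta + 2 -> `|z| <= beta + 2 -> `|y - z| <= e ->
    `|wide_coef s alpha beta y - wide_coef s alpha beta z| <= L * e.
  by move=> yB zB yz; apply: (le_trans (Lw2 _ _ yB zB)); rewrite ler_wpM2l.
have narrowE (y z y' z' : R) : `|y| <= beta + 2 -> `|z| <= beta + 2 ->
    `|y'| <= beta + 2 -> `|z'| <= beta + 2 -> `|y - y'| <= eta ->
    `|z - z'| <= eta ->
    `|profile_narrow s alpha beta y z - profile_narrow s alpha beta y' z'|
      <= 2 * L ^+ 2 * eta.
  move=> yB zB yB' zB' yy zz.
  have h1 := normr_mul_le _ _ _ _ Lc1 (cc _ _ _ yB yB' yy).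
  have h2 := normr_mul_le _ _ _ _ Lc2 (cc _ _ _ zB zB' zz).
  rewrite /profile_narrow.
  set u := narrow_coef_up _ _ _ in h1 *; set v := narrow_coef_down _ _ _ in h2 *.
  have -> : u * cosh (s * y) + v * cosh (s * z) -
      (u * cosh (s * y') + v * cosh (s * z')) =
      u * (cosh (s * y) - cosh (s * y')) + v * (cosh (s * z) - cosh (s * z')).
    by ring.
  apply: (le_trans (ler_normD _ _)); apply: (le_trans (lerD h1 h2)).
  by rewrite (_ : _ + _ = 2 * L ^+ 2 * eta)//; ring.
(* Exit through [alpha]: the overshoot is at most [eta], and the profile equals 1 on the level
   itself. *)
have [aea|aea] := leP alpha ae.
  have nal : ~~ alive alpha beta (Num.max ae 0) (Num.max be 0).
    by rewrite /alive gt_max ltNge aea.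
  move: (exit_gap _ _ nal) => gap.
  rewrite /stopped_profile (negbTE nal).
  apply: K1; [exact: le_trans gap| |exact: gap].
  rewrite /profile abe; case: ifPn => [rn|]; last rewrite -leNgt => rw.
    apply: (weaken _ 2); first by rewrite ler_nat.
    rewrite -[X in _ - X](profile_narrow_exit s alpha beta).
    by apply: narrowE; rewrite ler_norml; apply/andP; split; lin L.
  apply: (weaken _ 2); first by rewrite ler_nat.
  have h1 : `|cosh (s * ae) - cosh (s * alpha)| <= L * eta.
    by apply: cc; rewrite ler_norml; apply/andP; split; lin L.
  have h2 : `|sinh (s * (alpha - ae)) - sinh (s * 0)| <= L * eta.
    by apply: ss'; rewrite ler_norml; apply/andP; split; lin L.
  have h3 : `|wide_coef s alpha beta (a + b)| <= L by apply: WL; lin L.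
  rewrite /profile_wide abe.
  have := normr_mul_le _ _ _ _ h1 CV; have := normr_mul_le _ _ _ _ h3 h2.
  rewrite mulr0 sinh0 subr0 -/C mulrBl (mulrC s alpha) -/C divff ?gt_eqF// mulr1.
  set u := _ * sinh _; set v := _ / C => hu hv.
  have -> : v + u - 1 = (v - 1) + u by ring.
  apply: (le_trans (ler_normD _ _)); apply: (le_trans (lerD hv hu)).
  have : L * eta <= L ^+ 2 * eta by rewrite ler_wpM2r.
  by clear; lra.
(* Exit through [beta]. Since [a + b < beta], this makes [ae] negative, so [ae] lies within [eta] of
   0. *)
have [beb|beb] := leP beta be.
  have nal : ~~ alive alpha beta (Num.max ae 0) (Num.max be 0).
    by rewrite /alive !gt_max (ltNge be) beb /= andbF.
  move: (exit_gap _ _ nal) => gap.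
  rewrite /stopped_profile (negbTE nal).
  apply: K1; [exact: le_trans gap| |exact: gap].
  have h1 : `|cosh (s * ae) - cosh (s * 0)| <= L * eta.
    by apply: cc; rewrite ler_norml; apply/andP; split; lin L.
  rewrite /profile abe; case: ifPn => [rn|]; last rewrite -leNgt => rw.
    apply: (weaken _ 3); first by rewrite ler_nat.
    have h : `|profile_narrow s alpha beta ae be -
        profile_narrow s alpha beta 0 alpha| <= 2 * L ^+ 2 * eta.
      by apply: narrowE; rewrite ler_norml; apply/andP; split; lin L.
    have h' : `|edge_value s alpha beta - 1| <= L * eta.
      rewrite distrC ger0_norm ?subr_ge0 ?edge_value_le1//.
      apply: (le_trans (edge_value_gap s alpha beta s0 alpha0 alpha_le_beta)).
      apply: ler_pM => //; first exact: rate_up_ge0.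
        by rewrite subr_ge0.
      by lin L.
    rewrite profile_narrow_edge// in h.
    set u := profile_narrow _ _ _ _ _ in h *; set v := edge_value _ _ _ in h h' *.
    have -> : u - 1 = (u - v) + (v - 1) by ring.
    apply: (le_trans (ler_normD _ _)); apply: (le_trans (lerD h h')).
    have : L * eta <= L ^+ 2 * eta by rewrite ler_wpM2r.
    by clear; lra.
  apply: (weaken _ 3); first by rewrite ler_nat.
  have h2 : `|sinh (s * (alpha - ae)) - sinh (s * alpha)| <= L * eta.
    by apply: ss'; rewrite ler_norml; apply/andP; split; lin L.
  have h3 : `|wide_coef s alpha beta (a + b)| <= L by apply: WL; lin L.
  have h4 : `|wide_coef s alpha beta (a + b) - wide_coef s alpha beta beta|
      <= L * eta.
    by apply: ww; rewrite ler_norml; apply/andP; split; lin L.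
  rewrite /profile_wide abe.
  have := normr_mul_le _ _ _ _ h1 CV; have := normr_mul_le _ _ _ _ h3 h2.
  have := normr_mul_le _ _ _ _ h4 SL.
  have := wide_coef_beta s alpha beta s0 alpha0.
  rewrite mulr0 cosh0 -/S -/C (mulrC s alpha) -/S.
  set w := wide_coef _ _ _ (a + b); set w' := wide_coef _ _ _ beta.
  set c := cosh _; set sh := sinh _ => wS k1 k2 k3.
  (* The exit value 1 is rewritten as [C^-1 + w' * S]. *)
  have -> : c / C + w * sh - 1 = (c - 1) / C + w * (sh - S) + (w - w') * S.
    by move: wS => /eqP; rewrite -subr_eq0 => /eqP wS; rewrite -[RHS]addr0 -wS; ring.
  apply: (le_trans (ler_normD _ _)).
  apply: (le_trans (lerD (le_trans (ler_normD _ _) (lerD k3 k2)) k1)).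
  have : L * eta <= L ^+ 2 * eta by rewrite ler_wpM2r.
  by clear; lra.
have al : alive alpha beta (Num.max ae 0) (Num.max be 0).
  by rewrite /alive !gt_max aea beb alpha0 (lt_le_trans alpha0).
rewrite /stopped_profile al.
(* The free step preserves [a + b >= 0], so at most one coordinate is reflected; without reflection
   both sides vanish. *)
move: al; have [ae0|ae0] := leP 0 ae; have [be0|be0] := leP 0 be => al.
- by rewrite subrr normr0 /potential alive_ab al abe subrr mulr0.
(* Reflection at the maximum: the new range is [ae < alpha], hence the regime is narrow before and
   after. *)
- have d0 : 0 <= - be by rewrite oppr_ge0 ltW.
  have aeS : ae = a + b + - be by rewrite -abe addrK.
  have r' : ae < alpha by [].
  have r : a + b < alpha by lin L.
  rewrite /potential al alive_ab addr0 (leNgt alpha ae) r'.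
  rewrite (leNgt alpha) r /= !addr0 (_ : ae - (a + b) = - be); last first.
    by rewrite aeS addrAC subrr add0r.
  rewrite /profile abe r addr0 r'.
  rewrite /profile_narrow mulr0 cosh0 mulr1 opprD addrACA subrr add0r.
  rewrite -[X in _ - X]mulr1 -mulrBr.
  have beB : `|be| <= beta + 2 by rewrite ler_norml; apply/andP; split; lin L.
  apply: (le_trans (normr_mul_le _ _ _ _ Lc2 (Lcosh1 _ beB))).
  rewrite -sqrrN expr2 (mulrA L) (mulrA (L * L)).
  apply: ler_wpM2r => //.
  apply: ler_pM => //; [exact: mulr_ge0| |lin L].
  rewrite -expr2; apply: (le_trans LL3); rewrite ler_peMl ?exprn_ge0//.
  by rewrite ler1n.
- have d0 : 0 <= - ae by rewrite oppr_ge0 ltW.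
  have beS : be = a + b + - ae by rewrite -abe addrC addKr.
  rewrite /potential al alive_ab add0r.
  have aeB : `|ae| <= beta + 2 by rewrite ler_norml; apply/andP; split; lin L.
  have naeB : `|- ae| <= beta + 2 by rewrite normrN.
  rewrite /profile abe add0r.
  have [bn|bw] := ltP be alpha.
    have r : a + b < alpha by lin L.
    rewrite r (leNgt alpha) r /= !addr0.
    rewrite (_ : be - (a + b) = - ae); last by rewrite beS addrAC subrr add0r.
    rewrite /profile_narrow mulr0 cosh0 mulr1 opprD addrACA subrr addr0.
    rewrite -[X in _ - X]mulr1 -mulrBr.
    apply: (le_trans (normr_mul_le _ _ _ _ Lc1 (Lcosh1 _ aeB))).
    rewrite -sqrrN expr2 (mulrA L) (mulrA (L * L)).
    apply: ler_wpM2r => //.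
    apply: ler_pM => //; [exact: mulr_ge0| |lin L].
    rewrite -expr2; apply: (le_trans LL3); rewrite ler_peMl ?exprn_ge0//.
    by rewrite ler1n.
  have wbe := WL be; have {wbe}h1 : `|wide_coef s alpha beta be| <= L.
    by apply: wbe; lin L.
  rewrite /profile_wide mulr0 cosh0 subr0 add0r (mulrC s alpha) -/S -/C.
  (* Passage from narrow to wide: both profiles are compared with their common value at
     [(0, alpha)], and the indicator in [potential] supplies the jump. *)
  case: ifPn => [r|]; last rewrite -leNgt => r.
    rewrite (leNgt alpha (a + b)) r /= !addr0.
    apply: K1; [by lin L| |by lin L].
    apply: (weaken _ 3); first by rewrite ler_nat.
    have h : `|profile_narrow s alpha beta ae be -
        profile_narrow s alpha beta 0 alpha| <= 2 * L ^+ 2 * eta.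
      by apply: narrowE; rewrite ler_norml; apply/andP; split; lin L.
    have h' : `|wide_coef s alpha beta alpha - wide_coef s alpha beta be|
        <= L * eta.
      by apply: ww; rewrite ler_norml; apply/andP; split; lin L.
    have h2 := normr_mul_le _ _ _ _ h' SL.
    rewrite profile_narrow_edge// /edge_value -/S -/C in h.
    set u := profile_narrow _ _ _ _ _ in h *.
    set w := wide_coef _ _ _ alpha in h h2 *; set v := wide_coef _ _ _ be in h2 *.
    have -> : u - (1 / C + v * S) = (u - (C^-1 + w * S)) + (w - v) * S.
      by rewrite div1r; ring.
    apply: (le_trans (ler_normD _ _)); apply: (le_trans (lerD h h2)).
    by rewrite (_ : _ + _ = 3 * L ^+ 2 * eta)//; ring.
  rewrite r (_ : be + 1 - (a + b + 1) = - ae); last by rewrite beS; ring.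
  have dB : `|- ae| <= beta + 2 by rewrite normrN.
  have h2 := Lcosh1 _ aeB; have h3 := Lsinh1 _ dB; have h4 := Lexp _ dB.
  rewrite sqrrN in h3 h4.
  have h5 : `|wide_coef s alpha beta (a + b)| <= L by apply: WL; lin L.
  rewrite abe beS (wide_coefD _ _ _ (a + b) (- ae)).
  have -> : s * (alpha - ae) = alpha * s + s * - ae by ring.
  rewrite sinhD -/S -/C (_ : cosh (s * - ae) = cosh (s * ae)); last first.
    by rewrite mulrN coshN.
  (* The first-order terms cancel: this identity is the vanishing normal derivative that determines
     [rate_up]. *)
  have Sr : C * (s * - ae) = S * (- ae * rate_up s alpha).
    by rewrite /rate_up /coth -/S -/C; field; rewrite gt_eqF.
  have Cd : 0 <= ae ^+ 2 by exact: sqr_ge0.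
  have g1 := normr_mul_le _ _ _ _ h2 CV.
  have g2 := normr_mul_le _ _ _ _ SL h2.
  have g3 := normr_mul_le _ _ _ _ CL h3.
  have g4 := normr_mul_le _ _ _ _ SL h4.
  set w := wide_coef _ _ _ (a + b) in h5 *.
  set c := cosh _ in g1 g2 *; set sh := sinh (s * - ae) in g3 *.
  set t := - ae * rate_up s alpha in g4 Sr *; set y := s * - ae in g3 Sr *.
  rewrite (_ : _ - _ = (c - 1) / C + w * (S * (c - 1) + C * (sh - y)
     - S * (expR t - 1 - t)) + w * (C * y - S * t)); last by ring.
  rewrite Sr subrr mulr0 addr0.
  have g5 : `|S * (c - 1) + C * (sh - y) - S * (expR t - 1 - t)| <=
      3 * L ^+ 2 * ae ^+ 2.
    apply: (le_trans (ler_normB _ _)).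
    apply: (le_trans (lerD (le_trans (ler_normD _ _) (lerD g2 g3)) g4)).
    by rewrite (_ : _ + _ = 3 * L ^+ 2 * ae ^+ 2)//; ring.
  apply: (le_trans (ler_normD _ _)).
  apply: (le_trans (lerD g1 (normr_mul_le _ _ _ _ h5 g5))).
  have -> : 4 * L ^+ 3 * eta * - ae = 4 * L ^+ 3 * (eta * - ae) by ring.
  apply: (@le_trans _ _ (4 * L ^+ 3 * ae ^+ 2)).
    have := ler_wpM2r Cd (le_trans LL2 LL3).
    by clear; lra.
  apply: ler_wpM2l; first by rewrite mulr_ge0// exprn_ge0.
  by rewrite -sqrrN expr2; apply: ler_wpM2r => //; lin L.
- have : ae + be < 0 by lin L.
  by rewrite abe ltNge addr_ge0.
Qed.

(** * The reflected walk *)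

Section profile_path.
Context {R : realType}.
Implicit Types (s alpha beta a b x y eta c p : R) (xi : nat -> R).

(** Coefficient of [expR (s * x)] in the profile after a free step [x]; the branch depends only on
    [a + b], which such a step preserves. [profile_minus] is the coefficient of
    [expR (- (s * x))]. *)
Definition profile_plus s alpha beta a b :=
  if a + b < alpha then
    (narrow_coef_up s alpha beta * expR (s * a) +
     narrow_coef_down s alpha beta * expR (- (s * b))) / 2
  else
    (expR (s * a) / cosh (alpha * s) -
     wide_coef s alpha beta (a + b) * expR (- (s * (alpha - a)))) / 2.

Definition profile_minus s alpha beta a b :=
  if a + b < alpha then
    (narrow_coef_up s alpha beta * expR (- (s * a)) +
     narrow_coef_down s alpha beta * expR (s * b)) / 2
  else
    (expR (- (s * a)) / cosh (alpha * s) +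
     wide_coef s alpha beta (a + b) * expR (s * (alpha - a))) / 2.

(* This is what makes the time discretization exact away from reflections: both
   exponentials are eigenfunctions of the averaging over a Gaussian x. *)
Lemma profile_shift s alpha beta a b x :
  profile s alpha beta (a + x) (b - x) =
  profile_plus s alpha beta a b * expR (s * x) +
  profile_minus s alpha beta a b * expR (- (s * x)).
Proof.
rewrite /profile /profile_plus /profile_minus addrACA addrN addr0.
case: ifP => _; rewrite /profile_narrow /profile_wide /cosh /sinh.
  have -> : s * (a + x) = s * a + s * x by ring.
  have -> : s * (b - x) = s * b - s * x by ring.
  have -> : - (s * a + s * x) = - (s * a) - s * x by ring.
  have -> : - (s * b - s * x) = - (s * b) + s * x by ring.
  by rewrite !expRD; ring.
have -> : a + x + (b - x) = a + b by ring.
have -> : s * (a + x) = s * a + s * x by ring.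
have -> : - (s * a + s * x) = - (s * a) - s * x by ring.
have -> : s * (alpha - (a + x)) = s * (alpha - a) - s * x by ring.
have -> : - (s * (alpha - a) - s * x) = - (s * (alpha - a)) + s * x by ring.
by rewrite !expRD; ring.
Qed.

Lemma profile_split s alpha beta a b :
  profile s alpha beta a b =
  profile_plus s alpha beta a b + profile_minus s alpha beta a b.
Proof.
have := profile_shift s alpha beta a b 0.
by rewrite addr0 subr0 mulr0 oppr0 expR0 !mulr1.
Qed.

(** Controls the profile for increments too large for [profile_step_error], and makes the weights of
    the martingale increments bounded. *)
Lemma profile_coef_bounded s alpha beta : 0 < s -> 0 < alpha -> alpha <= beta ->
  exists2 K : R, 1 <= K & forall a b, 0 <= a -> 0 <= b -> a < alpha ->
    a + b < beta -> `|profile_plus s alpha beta a b| <= K /\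
                    `|profile_minus s alpha beta a b| <= K.
Proof.
move=> s0 alpha0 ab.
have [L L1 [_ [Lw _ Lc1 Lc2 _]]] := profile_constants s alpha beta s0 alpha0 ab.
have L0 : 0 <= L by exact: le_trans L1.
have beta0 : 0 < beta by exact: lt_le_trans ab.
pose E := expR (s * beta).
have E1 : 1 <= E by rewrite /E -expR0 ler_expR mulr_ge0 ?(ltW s0) ?(ltW beta0).
have E0 : 0 <= E by exact: le_trans E1.
have LE : 1 <= L * E by rewrite mulr_ege1.
exists (L * E) => // a b a0 b0 aalpha abbeta.
have eb y : y <= beta -> `|expR (s * y)| <= E.
  by move=> yb; rewrite ger0_norm ?expR_ge0// /E ler_expR ler_pM2l.
have ebN y : 0 <= y -> `|expR (- (s * y))| <= E.
  move=> y0; rewrite ger0_norm ?expR_ge0//; apply: le_trans E1.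
  by rewrite -expR0 ler_expR oppr_le0 mulr_ge0 ?(ltW s0).
have CV : `|(cosh (alpha * s))^-1| <= L.
  rewrite ger0_norm ?invr_ge0 ?(ltW (cosh_gt0 _))//; apply: le_trans L1.
  by rewrite invf_le1 ?cosh_gt0// cosh_ge1.
have W : `|wide_coef s alpha beta (a + b)| <= L.
  rewrite ger0_norm; last exact: wide_coef_ge0.
  by apply: Lw; apply: ltW; apply: (lt_le_trans abbeta); rewrite lerDl.
have half u v : `|u| <= L * E -> `|v| <= L * E -> `|(u + v) / 2| <= L * E.
  move=> ul vl; rewrite normrM (ger0_norm (_ : 0 <= 2^-1)) ?invr_ge0//.
  by rewrite ler_pdivrMr// mulr_natr mulr2n (le_trans (ler_normD _ _)) ?lerD.
have a_beta : a <= beta by apply: ltW; exact: lt_le_trans aalpha ab.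
have b_beta : b <= beta.
  by apply: ltW; apply: le_lt_trans abbeta; rewrite lerDr.
have aa0 : 0 <= alpha - a by rewrite subr_ge0 ltW.
have aab : alpha - a <= beta.
  by rewrite lerBlDr; apply: (le_trans ab); rewrite lerDl.
rewrite /profile_plus /profile_minus; case: ifP => _; split; apply: half.
- by apply: normr_mul_le => //; exact: eb.
- by apply: normr_mul_le => //; exact: ebN.
- by apply: normr_mul_le => //; exact: ebN.
- by apply: normr_mul_le => //; exact: eb.
- by rewrite mulrC; apply: normr_mul_le => //; exact: eb.
- by rewrite normrN; apply: normr_mul_le => //; exact: ebN.
- by rewrite mulrC; apply: normr_mul_le => //; exact: ebN.
- by apply: normr_mul_le => //; exact: eb.
Qed.

Lemma potential_step alpha beta a b x : 0 <= a -> 0 <= b ->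
  alive alpha beta a b -> a + b < beta ->
  potential alpha beta a b <=
  potential alpha beta (Num.max (a + x) 0) (Num.max (b - x) 0).
Proof.
move=> a0 b0 al abbeta.
have le1 : (if alpha <= a + b then 1 else 0) <= 1 :> R by case: ifP.
have sum : a + b <= Num.max (a + x) 0 + Num.max (b - x) 0.
  have -> : a + b = (a + x) + (b - x) by ring.
  by apply: lerD; rewrite le_max lexx.
rewrite /potential al; set al' := alive _ _ _ _; case: (boolP al') => _.
  apply: lerD => //; case: ifPn => h; last by case: ifP.
  by rewrite (le_trans h sum).
move: al le1 => /andP[] + + le1; clear -le1; lra.
Qed.

Lemma potential_bounds alpha beta a b : 0 <= a -> 0 <= b -> a + b < beta ->
  0 < alpha -> 0 <= potential alpha beta a b <= alpha + beta + 2.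
Proof.
move=> a0 b0 ab al; rewrite /potential; set c := alive _ _ _ _; case: c; last by lra.
by case: ifP => _; apply/andP; split; lra.
Qed.

(** If one coordinate is reflected, the new range is the other one, which lies below its own level;
    otherwise the range is unchanged. *)
Lemma alive_step alpha beta a b x : 0 < alpha -> alpha <= beta ->
  0 <= a -> 0 <= b -> a + b < beta ->
  alive alpha beta (Num.max (a + x) 0) (Num.max (b - x) 0) ->
  Num.max (a + x) 0 + Num.max (b - x) 0 < beta.
Proof.
move=> alpha0 ab a0 b0 abb /andP[].
by have [?|?] := leP 0 (a + x); have [?|?] := leP 0 (b - x); lra.
Qed.

(** Chernoff's device removes the restriction on [x]: when the absolute value of [x] exceeds [eta],
    a crude bound of order [exp (s |x|)] is multiplied by [exp (c (|x| - eta)) >= 1]. *)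
Lemma profile_step_error_exp s alpha beta :
  0 < s -> 0 < alpha -> alpha <= beta -> exists2 K : R, 0 <= K &
  forall a b x eta c, 0 <= a -> 0 <= b -> alive alpha beta a b ->
  a + b < beta -> 0 <= eta -> eta <= 1 -> 0 <= c ->
  `|profile s alpha beta (a + x) (b - x) -
    stopped_profile s alpha beta (Num.max (a + x) 0) (Num.max (b - x) 0)|
  <= K * (eta * (potential alpha beta (Num.max (a + x) 0) (Num.max (b - x) 0) -
                potential alpha beta a b) +
          expR (- (c * eta)) * (expR ((s + c) * x) + expR (- ((s + c) * x)))).
Proof.
move=> s0 alpha0 ab.
have [K K0 good] := profile_step_error s alpha beta s0 alpha0 ab.
have [M M1 coef] := profile_coef_bounded s alpha beta s0 alpha0 ab.
have M0 : 0 <= M by exact: le_trans M1.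
exists (K + 4 * M); first by rewrite addr_ge0// mulr_ge0.
move=> a b x eta c a0 b0 al abb eta0 eta1 c0.
move: (al) => /andP[aalpha bbeta].
have pot := potential_step alpha beta a b x a0 b0 al abb.
rewrite -subr_ge0 in pot.
have tail0 : 0 <= expR (- (c * eta)) *
    (expR ((s + c) * x) + expR (- ((s + c) * x))).
  by rewrite mulr_ge0 ?addr_ge0 ?expR_ge0.
have [xeta|xeta] := leP `|x| eta.
  apply: (le_trans (good a b x eta a0 b0 aalpha bbeta abb eta1 xeta)).
  rewrite [leRHS]mulrDr -[leLHS]addr0; apply: lerD; last first.
    by rewrite mulr_ge0 ?addr_ge0 ?mulr_ge0.
  rewrite -mulrA; apply: ler_wpM2r; first exact: mulr_ge0.
  by rewrite lerDl mulr_ge0.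
have ex y : expR (s * y) <= expR (s * `|y|).
  by rewrite ler_expR ler_pM2l// ler_norm.
have sx : expR (s * `|x|) <= expR (- (c * eta)) *
    (expR ((s + c) * x) + expR (- ((s + c) * x))).
  apply: (@le_trans _ _ (expR (- (c * eta)) * expR ((s + c) * `|x|))).
    rewrite -expRD ler_expR mulrDl [leRHS]addrC -addrA lerDl -mulrBr.
    by rewrite mulr_ge0// subr_ge0 ltW.
  rewrite ler_wpM2l ?expR_ge0//.
  by have [_|_] := ger0P x; rewrite ?mulrN ?lerDl ?lerDr expR_ge0.
have sx1 : 1 <= expR (s * `|x|).
  by rewrite -expR0 ler_expR mulr_ge0// ltW.
have h1 : `|profile s alpha beta (a + x) (b - x)| <= 2 * M * expR (s * `|x|).
  have [p1 p2] := coef a b a0 b0 aalpha abb.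
  rewrite profile_shift (le_trans (ler_normD _ _))// -mulrA mulr2n mulrDl mul1r.
  apply: lerD; apply: normr_mul_le => //; rewrite ger0_norm ?expR_ge0//.
  by rewrite -mulrN -(normrN x) ex.
have h2 : `|stopped_profile s alpha beta (Num.max (a + x) 0) (Num.max (b - x) 0)|
    <= 2 * M.
  rewrite /stopped_profile; case: ifPn => al'; last by rewrite normr1; lra.
  have := alive_step alpha beta a b x alpha0 ab a0 b0 abb al'.
  move: al' => /andP[a'alpha _] abb'.
  have a'0 : 0 <= Num.max (a + x) 0 by rewrite le_max lexx orbT.
  have b'0 : 0 <= Num.max (b - x) 0 by rewrite le_max lexx orbT.
  have [p1 p2] := coef _ _ a'0 b'0 a'alpha abb'.
  by rewrite profile_split (le_trans (ler_normD _ _))// mulr_natl mulr2n lerD.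
apply: (le_trans (ler_normB _ _)); apply: (le_trans (lerD h1 h2)).
apply: (@le_trans _ _ (4 * M * expR (s * `|x|))).
  have : M <= M * expR (s * `|x|) by rewrite ler_peMr.
  by clear; lra.
rewrite [leRHS]mulrDr -[leLHS]add0r; apply: lerD.
  by rewrite mulr_ge0 ?addr_ge0 ?mulr_ge0.
by apply: ler_pM => //; rewrite ?expR_ge0 ?lerDr ?mulr_ge0.
Qed.

(* With xi the increments of a path q, this is q n - min_(i <= n) q i; with
   - xi instead of xi it is max_(i <= n) q i - q n. *)
Fixpoint reflected xi n :=
  if n is m.+1 then Num.max (reflected xi m + xi m) 0 else 0.

Lemma reflected_ge0 xi n : 0 <= reflected xi n.
Proof. by case: n => // n; rewrite /= le_max lexx orbT. Qed.

Fixpoint survives alpha beta xi n :=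
  if n is m.+1 then
    survives alpha beta xi m &&
    alive alpha beta (reflected xi n) (reflected (fun j => - xi j) n)
  else true.

Lemma survivesP alpha beta xi n : 0 < alpha -> alpha <= beta ->
  survives alpha beta xi n ->
  alive alpha beta (reflected xi n) (reflected (fun j => - xi j) n) /\
  reflected xi n + reflected (fun j => - xi j) n < beta.
Proof.
move=> alpha0 ab; have beta0 := lt_le_trans alpha0 ab.
elim: n => [_|n IH /= /andP[/IH[_ h] al]]; first by rewrite /alive /= alpha0 addr0.
split=> //; apply: alive_step alpha0 ab _ _ h al; exact: reflected_ge0.
Qed.

(** With [tau] the exit step, this is [p ^+ min n tau] times the profile at that time, where the
    profile counts as 1 after exit. *)
Definition stopped_value s alpha beta p xi n :=
  (survives alpha beta xi n)%:R * p ^+ n *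
    profile s alpha beta (reflected xi n) (reflected (fun j => - xi j) n) +
  \sum_(j < n) (survives alpha beta xi j && ~~ survives alpha beta xi j.+1)%:R
    * p ^+ j.+1.

(** What [stopped_value] would gain in a step with neither reflection nor stopping: functions of the
    past times factors that are centred for Gaussian [xi k] and the right [p]. *)
Definition stopped_increment s alpha beta p xi k :=
  (survives alpha beta xi k)%:R * p ^+ k *
  (profile_plus s alpha beta (reflected xi k) (reflected (fun j => - xi j) k)
     * (p * expR (s * xi k) - 1) +
   profile_minus s alpha beta (reflected xi k) (reflected (fun j => - xi j) k)
     * (p * expR (- (s * xi k)) - 1)).

(** A pathwise statement: [potential] starts at a nonnegative value and never exceeds
    [alpha + beta + 2], so the reflection and exit errors add up to a multiple of [eta] independent
    of [n]. *)
Lemma stopped_value_error s alpha beta :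
  0 < s -> 0 < alpha -> alpha <= beta -> exists2 K : R, 0 <= K &
  forall p xi n eta c, 0 <= p -> p <= 1 -> 0 <= eta -> eta <= 1 -> 0 <= c ->
  `|stopped_value s alpha beta p xi n - profile s alpha beta 0 0 -
    \sum_(k < n) stopped_increment s alpha beta p xi k|
  <= K * (eta + expR (- (c * eta)) *
     \sum_(k < n) (expR ((s + c) * xi k) + expR (- ((s + c) * xi k)))).
Proof.
move=> s0 alpha0 ab.
have beta0 := lt_le_trans alpha0 ab.
have [K K0 step] := profile_step_error_exp s alpha beta s0 alpha0 ab.
pose top := alpha + beta + 2.
have top1 : 1 <= top by rewrite /top; lra.
exists (K * top); first by rewrite mulr_ge0// (le_trans _ top1).
move=> p xi n eta c p0 p1 eta0 eta1 c0.
pose a := reflected xi; pose b := reflected (fun j => - xi j).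
pose sv := survives alpha beta xi.
(* Frozen at the exit value [top] once the walk has left, so the increments of [rho] telescope over
   all steps. *)
pose rho k := if sv k then potential alpha beta (a k) (b k) else top.
pose tl k := expR (- (c * eta)) *
  (expR ((s + c) * xi k) + expR (- ((s + c) * xi k))).
have tl0 k : 0 <= tl k by rewrite mulr_ge0 ?addr_ge0 ?expR_ge0.
have rho_bounds k : 0 <= rho k <= top.
  rewrite /rho; case: ifPn => sk; last by rewrite lexx (le_trans _ top1).
  have [_ ?] := survivesP alpha beta xi k alpha0 ab sk.
  by apply: potential_bounds => //; exact: reflected_ge0.
suff main : `|stopped_value s alpha beta p xi n - profile s alpha beta 0 0 -
    \sum_(k < n) stopped_increment s alpha beta p xi k| <=
    K * (eta * (rho n - rho 0%N) + \sum_(k < n) tl k).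
  apply: (le_trans main); rewrite -mulrA; apply: ler_wpM2l => //.
  have sum0 : 0 <= \sum_(k < n) tl k by rewrite sumr_ge0.
  rewrite [in leRHS]mulr_sumr -/(\sum_(k < n) tl k) [leRHS]mulrDr.
  apply: lerD; last by rewrite ler_peMl.
  rewrite mulrC ler_wpM2r//.
  by have /andP[? _] := rho_bounds 0%N; have /andP[_ ?] := rho_bounds n; lra.
elim: n => [|n IH].
  rewrite /stopped_value !big_ord0 /= !mul1r !addr0 subrr subr0 normr0 subrr.
  by rewrite mulr0 mulr0.
rewrite !(big_ord_recr n) /=.
set D := _ - _ - \sum_(_ < _) _ in IH.
have -> : stopped_value s alpha beta p xi n.+1 - profile s alpha beta 0 0 -
    (\sum_(k < n) stopped_increment s alpha beta p xi k +
     stopped_increment s alpha beta p xi n) =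
    D + (stopped_value s alpha beta p xi n.+1 - stopped_value s alpha beta p xi n -
     stopped_increment s alpha beta p xi n) by rewrite /D; ring.
apply: (le_trans (ler_normD _ _)).
have -> : K * (eta * (rho n.+1 - rho 0%N) + (\sum_(k < n) tl k + tl n)) =
    K * (eta * (rho n - rho 0%N) + \sum_(k < n) tl k) +
    K * (eta * (rho n.+1 - rho n) + tl n) by ring.
apply: lerD => //.
rewrite {D IH} /stopped_value big_ord_recr /= /stopped_increment.
rewrite -/(a n) -/(b n) /rho /=.
rewrite -/(sv n) -/(a n) -/(b n).
set a' := Num.max _ 0; set b' := Num.max _ 0.
set sm := \sum_(_ < _) _.
have svS : sv n.+1 = sv n && alive alpha beta a' b' by [].
have [aS bS] : a n.+1 = a' /\ b n.+1 = b' by [].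
rewrite svS aS bS; case: (boolP (sv n)) => svn; last first.
  rewrite /= !mul0r !add0r addr0 !subrr normr0.
  by rewrite mulr0 add0r mulr_ge0.
have [al abb] := survivesP alpha beta xi n alpha0 ab svn.
have := step _ _ (xi n) eta c (reflected_ge0 _ _) (reflected_ge0 _ _) al abb eta0 eta1 c0.
rewrite -/(a n) -/(b n) -/a' -/b' => st.
rewrite /= !mul1r.
have st' : `|p ^+ n.+1 * (stopped_profile s alpha beta a' b' -
    profile s alpha beta (a n + xi n) (b n - xi n))| <=
    K * (eta * (potential alpha beta a' b' - potential alpha beta (a n) (b n)) +
    tl n).
  rewrite normrM distrC; apply: le_trans st; apply: ler_piMl => //.
  by rewrite ger0_norm ?exprn_ge0// exprn_ile1.
have topE : (if alive alpha beta a' b' then potential alpha beta a' b' else top)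
    = potential alpha beta a' b'.
  by rewrite /potential /top; case: (alive _ _ a' b').
rewrite topE; apply: le_trans st'; rewrite le_eqVlt; apply/orP; left; apply/eqP.
congr (`| _ |); rewrite profile_shift (profile_split _ _ _ (a n) (b n)).
rewrite /stopped_profile exprS.
by case: (alive alpha beta a' b') => /=; ring.
Qed.

End profile_path.

(** * Gaussian increments *)

Section density.
Local Open Scope ereal_scope.
Context {d} {T : measurableType d} {R : realType}.
Variables (mu nu : {measure set T -> \bar R}) (g : T -> R).
Hypotheses (mg : measurable_fun setT g) (g0 : forall x, (0 <= g x)%R).
Hypothesis nuE : forall A, measurable A -> nu A = \int[mu]_(x in A) (g x)%:E.

Import HBNNSimple.

Let integral_density_indic (r : R) (A : set T) : measurable A -> (0 <= r)%R ->
  \int[nu]_x (r * \1_A x)%:E = \int[mu]_x ((r * \1_A x)%:E * (g x)%:E).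
Proof.
move=> mA r0.
under eq_integral do rewrite EFinM.
rewrite ge0_integralZl//; last exact/measurable_EFinP/measurable_indic.
under [RHS]eq_integral do rewrite EFinM -muleA.
rewrite ge0_integralZl//; last 2 first.
- apply: emeasurable_funM; first exact/measurable_EFinP/measurable_indic.
  exact/measurable_EFinP.
- by move=> x _; rewrite mule_ge0// lee_fin.
congr (_ * _); rewrite integral_indic// setIT nuE// integral_mkcond.
apply: eq_integral => x _; rewrite patchE indicE.
by case: ifPn => xA; rewrite ?mul1e ?mul0e.
Qed.

Let integral_density_nnsfun (h : {nnsfun T >-> R}) :
  \int[nu]_x (h x)%:E = \int[mu]_x ((h x)%:E * (g x)%:E).
Proof.
under [LHS]eq_integral do rewrite fimfunE -fsumEFin//.
rewrite [LHS]ge0_integral_fsum//; last 2 first.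
- by move=> r; exact/measurable_EFinP/measurableT_comp.
- by move=> n x _; rewrite EFinM nnfun_muleindic_ge0.
under [RHS]eq_integral.
  move=> x xD; rewrite fimfunE -fsumEFin// ge0_mule_fsuml; last first.
    by move=> r; rewrite EFinM nnfun_muleindic_ge0.
  over.
rewrite [RHS]ge0_integral_fsum//; last 2 first.
- move=> r; apply: emeasurable_funM; last exact/measurable_EFinP.
  exact/measurable_EFinP/measurableT_comp.
- move=> n x _; apply: mule_ge0; last by rewrite lee_fin.
  by rewrite EFinM nnfun_muleindic_ge0.
apply: eq_fsbigr => r /[!inE] -[x _ <-].
by rewrite integral_density_indic.
Qed.

(** Extended from indicators to simple functions, then by monotone convergence. *)
Lemma ge0_integral_density (f : T -> \bar R) :
  measurable_fun setT f -> (forall x, 0 <= f x) ->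
  \int[nu]_x f x = \int[mu]_x (f x * (g x)%:E).
Proof.
move=> mf f0; pose f_ := nnsfun_approx measurableT mf.
have cvf x : (f_ n x)%:E @[n --> \oo] --> f x by exact: cvg_nnsfun_approx.
transitivity (limn (fun n => \int[nu]_x (f_ n x)%:E)).
  rewrite -monotone_convergence//=.
  - by apply: eq_integral => x _; apply/esym/cvg_lim.
  - by move=> n; exact/measurable_EFinP/measurable_funTS.
  - by move=> n x _; rewrite lee_fin.
  - by move=> x _ m n mn; rewrite lee_fin; exact/lefP/nd_nnsfun_approx.
rewrite (_ : (fun n => _) = fun n => \int[mu]_x ((f_ n x)%:E * (g x)%:E));
  last by apply/funext => n; exact: integral_density_nnsfun.
rewrite -monotone_convergence//=.
- apply: eq_integral => x _; apply/cvg_lim => //.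
  by apply: cvgeZr => //; exact: cvf.
- move=> n; apply: emeasurable_funM; last exact/measurable_EFinP.
  exact/measurable_EFinP/measurable_funTS.
- by move=> n x _; rewrite mule_ge0// lee_fin.
- move=> x _ m n mn; apply: lee_wpmul2r; rewrite ?lee_fin//.
  exact/lefP/nd_nnsfun_approx.
Qed.

End density.

Section normal_mgf.
Context {R : realType}.
Implicit Types c sigma x : R.

(** Completing the square in the exponent: the tilt shifts the mean by [c * sigma ^+ 2]. *)
Lemma normal_pdf_tilt c sigma x : sigma != 0 ->
  expR (c * x) * normal_pdf 0 sigma x =
  expR (c ^+ 2 * sigma ^+ 2 / 2) * normal_pdf (c * sigma ^+ 2) sigma x.
Proof.
move=> s0; rewrite /normal_pdf (negbTE s0).
rewrite !(mulrCA (expR _)); congr (_ * _); rewrite /normal_fun -!expRD.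
congr expR; rewrite -mulr_natr; field.
by [].
Qed.

Lemma normal_mgf (nu : {measure set (measurableTypeR R) -> \bar R}) c sigma : sigma != 0 ->
  (forall A, measurable A -> nu A = normal_prob 0 sigma A) ->
  (\int[nu]_x (expR (c * x))%:E =
   (expR (c ^+ 2 * sigma ^+ 2 / 2))%:E)%E.
Proof.
move=> s0 nuE; rewrite (@ge0_integral_density _ _ _ lebesgue_measure nu
  (normal_pdf 0 sigma) (measurable_normal_pdf _ _) (normal_pdf_ge0 _ _) nuE)//.
2: apply/measurable_EFinP; apply: measurableT_comp => //.
under eq_integral do rewrite -EFinM normal_pdf_tilt// EFinM.
rewrite ge0_integralZl//.
- by rewrite integral_normal_pdf mule1.
- by apply/measurable_EFinP; exact: measurable_normal_pdf.
- by move=> x _; rewrite lee_fin normal_pdf_ge0.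
Qed.

End normal_mgf.

(** * Independence of the past *)

Section past.
Context {d} {Omega : measurableType d} {R : realType}.
Variables (P : probability Omega R) (Y : nat -> Omega -> R).
Hypothesis mY : forall k, measurable_fun setT (Y k).
Variable n : nat.

(** Rectangles are stable under intersection, which uniqueness of measures on the generated
    sigma-algebra requires. *)
Definition past_rectangles : set (set Omega) :=
  [set A | exists2 B : 'I_n -> set R, (forall i, measurable (B i)) &
     A = \bigcap_(i in [set: 'I_n]) (Y i @^-1` B i)].

(** A second measurable structure on [Omega]: depending on [Y 0], ..., [Y (n - 1)] alone becomes
    measurability on this type. *)
Definition past := g_sigma_algebraType past_rectangles.

HB.instance Definition _ := Measurable.on past.

Lemma measurable_past k : (k < n)%N ->
  measurable_fun setT (Y k : past -> R).
Proof.
move=> kn _ B mB; rewrite setTI; apply: sub_sigma_algebra.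
exists (fun i : 'I_n => if i == Ordinal kn then B else setT).
  by move=> i; case: ifP.
apply/seteqP; split=> [w Bw i _|w /(_ (Ordinal kn) I)]; last by rewrite eqxx.
by case: eqVneq => [->|].
Qed.

Hypothesis Yindep : mutually_independent P (fun i : 'I_n.+1 => Y i).

Let mYB k (B : set R) : measurable B -> measurable (Y k @^-1` B).
Proof. by move=> mB; rewrite -[X in measurable X]setTI; exact: mY. Qed.

Let past_rectangles_measurable : past_rectangles `<=` measurable.
Proof.
move=> _ [B mB ->]; apply: fin_bigcap_measurable => // i _; exact: mYB.
Qed.

Lemma past_measurable A : <<s past_rectangles >> A -> measurable A.
Proof.
have := smallest_sub (@sigma_algebra_measurable _ Omega) past_rectangles_measurable.
exact.
Qed.

(** As functions of [A], the two sides are finite measures that agree on [past_rectangles], hence on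
    the sigma-algebra these generate. *)
Lemma past_independent (A : set Omega) (B : set R) :
  <<s past_rectangles >> A -> measurable B ->
  P (A `&` Y n @^-1` B) = (P A * P (Y n @^-1` B))%E.
Proof.
move=> sA mB.
have rect (F : 'I_n -> set R) (C : set R) : (forall i, measurable (F i)) ->
    measurable C ->
    P (\bigcap_(i in [set: 'I_n]) (Y i @^-1` F i) `&` Y n @^-1` C) =
    (\prod_(i < n) P (Y i @^-1` F i) * P (Y n @^-1` C))%E.
  move=> mF mC.
  pose G (i : 'I_n.+1) := if insub (val i) is Some j then F j else C.
  have Gw (i : 'I_n) : G (widen_ord (leqnSn n) i) = F i.
    by rewrite /G /= valK.
  have Gn : G ord_max = C by rewrite /G insubF //= ltnn.
  have mG i : measurable (G i) by rewrite /G; case: insub.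
  have := Yindep G mG; rewrite big_ord_recr /= Gn.
  under eq_bigr do rewrite Gw.
  move=> <-; congr (P _); apply/seteqP; split=> [w [wF wC] i _|w wG]; last first.
    split=> [i _|]; last by have := wG ord_max I; rewrite /= Gn.
    by have := wG (widen_ord (leqnSn n) i) I; rewrite /= Gw.
  have [iltn|] := ltnP i n.
    by have := wF (Ordinal iltn) I; rewrite /G /= insubT.
  rewrite leq_eqVlt => /predU1P[ni|]; last by rewrite ltnNge -ltnS ltn_ord.
  have -> : i = ord_max by apply: val_inj.
  by rewrite Gn.
have rect0 (F : 'I_n -> set R) : (forall i, measurable (F i)) ->
    P (\bigcap_(i in [set: 'I_n]) (Y i @^-1` F i)) =
    (\prod_(i < n) P (Y i @^-1` F i))%E.
  move=> mF; have := rect F setT mF measurableT.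
  by rewrite preimage_setT setIT probability_setT mule1.
have pfin : P (Y n @^-1` B) \is a fin_num by exact: fin_num_measure (mYB n B mB).
have p0 : 0 <= fine (P (Y n @^-1` B)) by exact: fine_ge0.
pose m1 := mrestr P (mYB n B mB).
pose m2 := mscale (NngNum p0) P.
rewrite muleC -[P (Y n @^-1` B)]fineK//.
apply: (@g_sigma_algebra_measure_unique _ _ _ past_rectangles
  past_rectangles_measurable (fun=> setT) _ _ m1 m2 _ _ _ A sA).
- move=> _; exists (fun=> setT) => //.
  by apply/seteqP; split.
- by apply/seteqP; split=> // w _; exists 0%N.
- move=> _ _ [F mF ->] [G mG ->]; exists (fun i => F i `&` G i).
    by move=> i; exact: measurableI.
  by rewrite bigcapI.
- move=> _ [F mF ->]; rewrite /m1 /m2 /= /mrestr /mscale /= fineK//.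
  by rewrite rect// muleC rect0.
- by move=> _; rewrite /m1 /= /mrestr setTI ltey_eq pfin.
Qed.

(** The identity into [past] and [Y n] have a product joint law by [past_independent]; nonnegativity
    then permits Tonelli without integrability. *)
Lemma past_integral_mul (Phi : past -> R) (f : R -> R) :
  measurable_fun setT Phi -> (forall w, 0 <= Phi w) ->
  measurable_fun setT f -> (forall x, 0 <= f x) ->
  (\int[P]_w (Phi w * f (Y n w))%:E =
   \int[P]_w (Phi w)%:E * \int[P]_w (f (Y n w))%:E)%E.
Proof.
move=> mPhi Phi0 mf f0.
have mid : measurable_fun setT (id : Omega -> past).
  by move=> _ A mA; rewrite setTI preimage_id; exact: past_measurable.
have mpair : measurable_fun setT ((fun w => (w, Y n w)) : Omega -> (past * R)%type).
  exact: measurable_fun_pair.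
pose X1 : {RV P >-> past} := HB.pack (id : Omega -> past)
  (isMeasurableFun.Build _ _ _ _ _ mid).
pose X2 : {RV P >-> R} := HB.pack (Y n : Omega -> R)
  (isMeasurableFun.Build _ _ _ _ _ (mY n)).
pose X3 : {RV P >-> (past * R)%type} := HB.pack
  ((fun w => (w, Y n w)) : Omega -> (past * R)%type)
  (isMeasurableFun.Build _ _ _ _ _ mpair).
pose g (z : (past * R)%type) := (Phi z.1 * f z.2)%:E.
have mg : measurable_fun setT g.
  apply/measurable_EFinP; apply: measurable_funM.
    exact: measurableT_comp mPhi measurable_fst.
  exact: measurableT_comp mf measurable_snd.
have g0 z : (0 <= g z)%E by rewrite lee_fin mulr_ge0.
have -> : (\int[P]_w (Phi w * f (Y n w))%:E = \int[distribution P X3]_z g z)%E.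
  by rewrite ge0_integral_distribution.
have -> : (\int[distribution P X3]_z g z =
    \int[distribution P X1 \x distribution P X2]_z g z)%E.
  apply: eq_measure_integral => A mA _; apply/esym.
  apply: product_measure_unique => // B C mB mC.
  rewrite /distribution /pushforward /= -past_independent//.
have -> : (\int[P]_w (Phi w)%:E = \int[distribution P X1]_w (Phi w)%:E)%E.
  rewrite ge0_integral_distribution//; exact/measurable_EFinP.
have -> : (\int[P]_w (f (Y n w))%:E = \int[distribution P X2]_y (f y)%:E)%E.
  rewrite ge0_integral_distribution//; exact/measurable_EFinP.
rewrite fubini_tonelli1// /fubini_F /g /=.
have inner w : (\int[distribution P X2]_y (Phi w * f y)%:E =
    (Phi w)%:E * \int[distribution P X2]_y (f y)%:E)%E.
  under eq_integral do rewrite EFinM.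
  apply: ge0_integralZl => //; first exact/measurable_EFinP.
    by move=> y _; rewrite lee_fin.
  by rewrite lee_fin.
transitivity (\int[distribution P X1]_w ((Phi w)%:E *
    \int[distribution P X2]_y (f y)%:E))%E.
  by apply: eq_integral => w _; rewrite -inner.
apply: ge0_integralZr => //; first exact/measurable_EFinP.
  by move=> w _; rewrite lee_fin.
by apply: integral_ge0 => y _; rewrite lee_fin.
Qed.

End past.

Notation L1 P f := (P.-integrable setT (EFin \o f)).

(** * Real-valued integrals under a probability *)

Section real_integrable.
Context {d} {T : measurableType d} {R : realType} (P : probability T R).
Implicit Types (f g : T -> R).

Lemma L1D f g : L1 P f -> L1 P g -> L1 P (fun w => f w + g w).
Proof. by move=> fi gi; have := integrableD measurableT fi gi; exact. Qed.

Lemma L1B f g : L1 P f -> L1 P g -> L1 P (fun w => f w - g w).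
Proof. by move=> fi gi; have := integrableB measurableT fi gi; exact. Qed.

Lemma L1Z (c : R) f : L1 P f -> L1 P (fun w => c * f w).
Proof. by move=> fi; have := integrableZl measurableT c fi; exact. Qed.

Lemma L1_bounded f (M : R) : measurable_fun setT f ->
  (forall w, `|f w| <= M) -> L1 P f.
Proof.
move=> mf fM; apply: measurable_bounded_integrable => //.
  by rewrite (le_lt_trans (probability_le1 _ _))// ltry.
exists M; split; first exact: num_real.
by move=> x Mx w _; apply: (le_trans (fM w)); exact: ltW.
Qed.

Lemma L1_cst (c : R) : L1 P (cst c).
Proof. exact: (@L1_bounded _ `|c|). Qed.

Lemma L1_sum n (f : nat -> T -> R) : (forall k, (k < n)%N -> L1 P (f k)) ->
  L1 P (fun w => \sum_(k < n) f k w).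
Proof.
elim: n => [|n IH] fi.
  by under eq_fun do rewrite big_ord0; exact: L1_cst.
under eq_fun do rewrite big_ord_recr /=; apply: L1D; last exact: fi.
by apply: IH => k kn; apply: fi; exact: ltnW.
Qed.

Lemma Rintegral_sum n (f : nat -> T -> R) : (forall k, (k < n)%N -> L1 P (f k)) ->
  \int[P]_w (\sum_(k < n) f k w) = \sum_(k < n) \int[P]_w f k w.
Proof.
elim: n => [|n IH] fi.
  under eq_Rintegral do rewrite big_ord0.
  by rewrite Rintegral_cst// mul0r big_ord0.
under eq_Rintegral do rewrite big_ord_recr /=; rewrite big_ord_recr /=.
have fi' k : (k < n)%N -> L1 P (f k) by move=> kn; apply: fi; exact: ltnW.
rewrite RintegralD//; [by rewrite IH|exact: L1_sum|exact: fi].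
Qed.

Lemma Rintegral_prob_cst (c : R) : \int[P]_(w in setT) c = c.
Proof. by rewrite Rintegral_cst//= probability_setT mulr1. Qed.

End real_integrable.

(** * Measurability of the functionals of the walk *)

Section chain_measurability.
Context {d} {T : measurableType d} {R : realType}.
Variables (y : nat -> T -> R) (n : nat).
Hypothesis my : forall k, (k < n)%N -> measurable_fun setT (y k).

(** Only the first [n] increments are assumed measurable, so that this also applies with [past Y n]
    as the underlying space. *)
Lemma measurable_reflected k : (k <= n)%N ->
  measurable_fun setT (fun w => reflected (fun j => y j w) k).
Proof.
elim: k => [_|k IH kn] /=; first exact: measurable_cst.
apply: measurable_maxr; last exact: measurable_cst.
by apply: measurable_funD; [apply: IH; exact: ltnW|exact: my].
Qed.

End chain_measurability.

Section chain_functionals.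
Context {d} {T : measurableType d} {R : realType}.
Variables (s alpha beta : R) (y : nat -> T -> R) (n : nat).
Hypothesis my : forall k, (k < n)%N -> measurable_fun setT (y k).

Let up k w := reflected (fun j => y j w) k.
Let down k w := reflected (fun j => - y j w) k.

Let mup k : (k <= n)%N -> measurable_fun setT (up k).
Proof. exact: measurable_reflected. Qed.

Let mdown k : (k <= n)%N -> measurable_fun setT (down k).
Proof.
apply: (@measurable_reflected _ _ _ (fun j w => - y j w)) => j jn.
by apply: measurableT_comp => //; exact: my.
Qed.

Lemma measurable_survives k : (k <= n)%N ->
  measurable_fun setT (fun w => survives alpha beta (fun j => y j w) k).
Proof.
elim: k => [_|k IH kn] /=; first exact: measurable_cst.
apply: measurable_and; first by apply: IH; exact: ltnW.
apply: measurable_and; apply: measurable_fun_ltr; try exact: measurable_cst.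
  exact: (mup _ kn).
exact: (mdown _ kn).
Qed.

Let mexp (c : R) (f : T -> R) : measurable_fun setT f ->
  measurable_fun setT (fun w => expR (c * f w)).
Proof.
by move=> mf; apply: measurableT_comp => //; apply: measurable_funM.
Qed.

Let mwide (f : T -> R) : measurable_fun setT f ->
  measurable_fun setT (fun w => wide_coef s alpha beta (f w)).
Proof.
move=> mf; rewrite /wide_coef; apply: measurable_funM => //.
apply: measurable_funM => //; apply: measurableT_comp => //.
apply: measurableT_comp => //; apply: measurable_funM => //.
exact: measurable_funB.
Qed.

Let msum k : (k <= n)%N -> measurable_fun setT (fun w => up k w + down k w).
Proof. by move=> kn; apply: measurable_funD; [exact: mup|exact: mdown]. Qed.

Let mexpN (c : R) (f : T -> R) : measurable_fun setT f ->
  measurable_fun setT (fun w => expR (- (c * f w))).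
Proof. by move=> mf; under eq_fun do rewrite -mulNr; exact: mexp. Qed.

Lemma measurable_profile_plus k : (k <= n)%N ->
  measurable_fun setT (fun w => profile_plus s alpha beta (up k w) (down k w)).
Proof.
move=> kn; rewrite /profile_plus; apply: measurable_fun_ifT.
- by apply: measurable_fun_ltr => //; exact: msum.
- apply: measurable_funM => //; apply: measurable_funD; apply: measurable_funM => //.
    by apply: mexp; exact: mup.
  by apply: mexpN; exact: mdown.
- apply: measurable_funM => //; apply: measurable_funB; apply: measurable_funM => //.
  + by apply: mexp; exact: mup.
  + by apply: mwide; exact: msum.
  + by apply: mexpN; apply: measurable_funB => //; exact: mup.
Qed.

Lemma measurable_profile_minus k : (k <= n)%N ->
  measurable_fun setT (fun w => profile_minus s alpha beta (up k w) (down k w)).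
Proof.
move=> kn; rewrite /profile_minus; apply: measurable_fun_ifT.
- by apply: measurable_fun_ltr => //; exact: msum.
- apply: measurable_funM => //; apply: measurable_funD; apply: measurable_funM => //.
    by apply: mexpN; exact: mup.
  by apply: mexp; exact: mdown.
- apply: measurable_funM => //; apply: measurable_funD; apply: measurable_funM => //.
  + by apply: mexpN; exact: mup.
  + by apply: mwide; exact: msum.
  + by apply: mexp; apply: measurable_funB => //; exact: mup.
Qed.

Lemma measurable_survives_indic k : (k <= n)%N ->
  measurable_fun setT (fun w => (survives alpha beta (fun j => y j w) k)%:R : R).
Proof.
move=> kn.
rewrite (_ : (fun w => _) = fun w =>
  if survives alpha beta (fun j => y j w) k then 1 else 0); last first.
  by apply/funext => w; case: survives.
by apply: measurable_fun_ifT => //; exact: measurable_survives.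
Qed.

Lemma measurable_exit_indic k : (k < n)%N ->
  measurable_fun setT (fun w => (survives alpha beta (fun j => y j w) k &&
    ~~ survives alpha beta (fun j => y j w) k.+1)%:R : R).
Proof.
move=> kn.
rewrite (_ : (fun w => _) = fun w =>
  if survives alpha beta (fun j => y j w) k &&
    ~~ survives alpha beta (fun j => y j w) k.+1 then 1 else 0); last first.
  by apply/funext => w; case: (_ && _).
apply: measurable_fun_ifT => //; apply: measurable_and.
  by apply: measurable_survives; exact: ltnW.
by apply: measurable_neg; exact: measurable_survives.
Qed.

End chain_functionals.

(** * Centred increments and the expected discounted exit *)

Section walk_expectation.
Context {d} {Omega : measurableType d} {R : realType} (P : probability Omega R).
Variables (Y : nat -> Omega -> R) (h : R).
Hypothesis mY : forall k, measurable_fun setT (Y k).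
Hypothesis Yindep : forall n, mutually_independent P (fun i : 'I_n => Y i).
Hypothesis Ymgf : forall k c,
  (\int[P]_w (expR (c * Y k w))%:E = (expR (c ^+ 2 * h / 2))%:E)%E.

Let mexpY k c : measurable_fun setT (fun w => expR (c * Y k w)).
Proof. by apply: measurableT_comp => //; apply: measurable_funM. Qed.

Lemma L1_expY k c : L1 P (fun w => expR (c * Y k w)).
Proof.
apply/integrableP; split; first exact/measurable_EFinP/mexpY.
under eq_integral do rewrite /= ger0_norm ?expR_ge0//.
by rewrite Ymgf ltry.
Qed.

Lemma Rintegral_expY k c : \int[P]_w expR (c * Y k w) = expR (c ^+ 2 * h / 2).
Proof. by rewrite /Rintegral Ymgf. Qed.

Let past_meas n (f : past Y n -> R) : measurable_fun setT f ->
  measurable_fun setT (f : Omega -> R).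
Proof.
move=> mf mT B mB; have := mf measurableT B mB.
exact: past_measurable.
Qed.

(** The product rule [past_integral_mul] wants a nonnegative factor, so [Phi] is replaced by
    [Phi + M] and the part due to [M], centred as well, is subtracted. *)
Lemma martingale_increment n (Phi : past Y n -> R) (M p c : R) :
  measurable_fun setT Phi -> (forall w, `|Phi w| <= M) ->
  p * expR (c ^+ 2 * h / 2) = 1 ->
  L1 P (fun w => Phi w * (p * expR (c * Y n w) - 1)) /\
  \int[P]_w (Phi w * (p * expR (c * Y n w) - 1)) = 0.
Proof.
move=> mPhi PhiM pE.
pose Psi : past Y n -> R := fun w => Phi w + M.
have mPsi : measurable_fun setT Psi by apply: measurable_funD.
have Psi0 w : 0 <= Psi w.
  by have := PhiM w; rewrite ler_norml /Psi => /andP[]; lra.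
have L1Psi : L1 P (Psi : Omega -> R).
  apply: (@L1_bounded _ _ _ _ _ (M + M)); first exact: past_meas.
  by move=> w; apply: (le_trans (ler_normD _ _)); apply: lerD => //;
     rewrite ger0_norm// (le_trans _ (PhiM w)).
have M0 : 0 <= M by apply: le_trans (PhiM point).
have mul := past_integral_mul P Y mY n (Yindep n.+1) Psi
  (fun x => expR (c * x)) mPsi Psi0.
have {mul}mul : (\int[P]_w (Psi w * expR (c * Y n w))%:E =
    \int[P]_w (Psi w)%:E * (expR (c ^+ 2 * h / 2))%:E)%E.
  have mfe : measurable_fun setT (fun x : R => expR (c * x)).
    by apply: measurableT_comp => //; apply: measurable_funM.
  by rewrite -(Ymgf n) -(mul mfe (fun x => expR_ge0 _)).
have PsiE : (\int[P]_w (Psi w)%:E = (\int[P]_w Psi w)%:E)%E.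
  rewrite /Rintegral fineK//; exact: integrable_fin_num.
have L1PY : L1 P (fun w => Psi w * expR (c * Y n w)).
  apply/integrableP; split.
    apply/measurable_EFinP; apply: measurable_funM; first exact: past_meas.
    exact: mexpY.
  under eq_integral do rewrite /= ger0_norm ?mulr_ge0 ?expR_ge0//.
  by rewrite mul PsiE -EFinM ltry.
have ILPY : \int[P]_w (Psi w * expR (c * Y n w)) =
    \int[P]_w Psi w * expR (c ^+ 2 * h / 2).
  by rewrite /Rintegral mul PsiE.
have L1Y := L1_expY n c.
have decomp w : Phi w * (p * expR (c * Y n w) - 1) =
    (p * (Psi w * expR (c * Y n w)) - Psi w) -
    (M * p * expR (c * Y n w) - M) by rewrite /Psi; ring.
have i1 : L1 P (fun w => p * (Psi w * expR (c * Y n w)) - Psi w).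
  by apply: L1B => //; exact: L1Z.
have i2 : L1 P (fun w => M * p * expR (c * Y n w) - M).
  by apply: L1B; [exact: L1Z|exact: L1_cst].
split; first by under eq_fun do rewrite decomp; exact: L1B.
under eq_Rintegral do rewrite decomp.
rewrite RintegralB// RintegralB//; last exact: L1Z.
rewrite RintegralB//; [|exact: L1Z|exact: L1_cst].
rewrite RintegralZl// RintegralZl// ILPY Rintegral_expY Rintegral_prob_cst.
by rewrite mulrCA pE mulr1 subrr -mulrA pE mulr1 subrr subrr.
Qed.

End walk_expectation.

(** The index is the last live step: the exit itself takes place at step [j.+1], hence the discount
    [p ^+ j.+1] below. *)
Definition exits {R : realType} (alpha beta : R) (xi : nat -> R) j :=
  survives alpha beta xi j && ~~ survives alpha beta xi j.+1.

(** Optional stopping: taking expectations in [stopped_value_error] removes the increments, and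
    walks still alive at step [n] contribute at most a multiple of [p ^+ n]. [K] is chosen before
    the space, the walk and [h], so the mesh can be refined later. *)
Lemma expected_exit {R : realType} (s alpha beta : R) :
  0 < s -> 0 < alpha -> alpha <= beta -> exists2 K : R, 0 <= K &
  forall d (Omega : measurableType d) (P : probability Omega R)
    (Y : nat -> Omega -> R) (h p eta c : R) (n : nat),
  (forall k, measurable_fun setT (Y k)) ->
  (forall n, mutually_independent P (fun i : 'I_n => Y i)) ->
  (forall k c,
    (\int[P]_w (expR (c * Y k w))%:E = (expR (c ^+ 2 * h / 2))%:E)%E) ->
  0 <= p -> p <= 1 -> p * expR (s ^+ 2 * h / 2) = 1 ->
  0 <= eta -> eta <= 1 -> 0 <= c ->
  `|\sum_(j < n) p ^+ j.+1 *
      \int[P]_w (exits alpha beta (fun i => Y i w) j)%:R -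
    profile s alpha beta 0 0| <=
  K * (eta + expR (- (c * eta)) * (n%:R * (2 * expR ((s + c) ^+ 2 * h / 2))) +
       p ^+ n).
Proof.
move=> s0 alpha0 ab.
have [K K0 err] := stopped_value_error s alpha beta s0 alpha0 ab.
have [M M1 coef] := profile_coef_bounded s alpha beta s0 alpha0 ab.
have M0 : 0 <= M by exact: le_trans M1.
exists (K + 2 * M); first by rewrite addr_ge0// mulr_ge0.
move=> d Omega P Y h p eta c n mY Yindep Ymgf p0 p1 pE eta0 eta1 c0.
pose xi w i := Y i w.
pose a w k := reflected (xi w) k; pose b w k := reflected (fun j => - xi w j) k.
have coefb w k : survives alpha beta (xi w) k ->
    `|profile_plus s alpha beta (a w k) (b w k)| <= M /\
    `|profile_minus s alpha beta (a w k) (b w k)| <= M.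
  move=> /(survivesP alpha beta (xi w) k alpha0 ab)[/andP[? _] ?].
  by apply: coef => //; exact: reflected_ge0.
have pk k : `|p ^+ k| <= 1 by rewrite ger0_norm ?exprn_ge0// exprn_ile1.
have bnd (z : R) (t : bool) k : (t -> `|z| <= M) -> `|t%:R * p ^+ k * z| <= M.
  case: t => [/(_ isT) zM|_]; last by rewrite !mul0r normr0.
  by rewrite mul1r -(mul1r M); apply: normr_mul_le.
pose inc k w := stopped_increment s alpha beta p (xi w) k.
have inc0 k : L1 P (inc k) /\ \int[P]_w inc k w = 0.
  pose F1 : past Y k -> R := fun w => (survives alpha beta (xi w) k)%:R * p ^+ k *
    profile_plus s alpha beta (a w k) (b w k).
  pose F2 : past Y k -> R := fun w => (survives alpha beta (xi w) k)%:R * p ^+ k *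
    profile_minus s alpha beta (a w k) (b w k).
  have mpast j : (j < k)%N -> measurable_fun setT (Y j : past Y k -> R).
    exact: measurable_past.
  have mF1 : measurable_fun setT F1.
    apply: measurable_funM; last exact: (measurable_profile_plus _ _ _ _ _ mpast).
    apply: measurable_funM => //.
    exact: (measurable_survives_indic _ _ _ _ mpast).
  have mF2 : measurable_fun setT F2.
    apply: measurable_funM; last exact: (measurable_profile_minus _ _ _ _ _ mpast).
    apply: measurable_funM => //.
    exact: (measurable_survives_indic _ _ _ _ mpast).
  have F1M w : `|F1 w| <= M by apply: bnd => /coefb[].
  have F2M w : `|F2 w| <= M by apply: bnd => /coefb[].
  have [i1 e1] := martingale_increment P Y h mY Yindep Ymgf k F1 M p s mF1 F1M pE.
  have pE' : p * expR ((- s) ^+ 2 * h / 2) = 1 by rewrite sqrrN.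
  have [i2 e2] := martingale_increment P Y h mY Yindep Ymgf k F2 M p (- s) mF2 F2M pE'.
  have incE w : inc k w = F1 w * (p * expR (s * Y k w) - 1) +
      F2 w * (p * expR (- s * Y k w) - 1).
    by rewrite mulNr /inc /stopped_increment /F1 /F2 mulrDr !mulrA.
  split; first by rewrite (funext incE); exact: L1D.
  under eq_Rintegral do rewrite incE.
  by rewrite RintegralD// e1 e2 addr0.
have mYn k j : (j < k)%N -> measurable_fun setT (Y j) by [].
pose ex j w : R := (exits alpha beta (xi w) j)%:R.
have L1ex j : L1 P (ex j).
  apply: (@L1_bounded _ _ _ _ _ 1).
    exact: (measurable_exit_indic _ _ _ _ (mYn j.+1)).
  by move=> w; rewrite /ex; case: (exits _ _ _ _); rewrite ?normr1 ?normr0.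
(* The part of [stopped_value] on which no exit has occurred by step [n]. *)
pose last w : R := (survives alpha beta (xi w) n)%:R * p ^+ n *
  profile s alpha beta (a w n) (b w n).
have lastM w : `|last w| <= 2 * M * p ^+ n.
  rewrite /last -mulrA (mulrC (p ^+ n)) mulrA normrM (ger0_norm (exprn_ge0 _ p0)).
  apply: ler_wpM2r; first exact: exprn_ge0.
  case: (boolP (survives _ _ _ _)) => [/coefb[h1 h2]|_]; last first.
    by rewrite mul0r normr0 mulr_ge0.
  rewrite mul1r profile_split; apply: (le_trans (ler_normD _ _)).
  by rewrite mulr_natl mulr2n lerD.
have L1last : L1 P last.
  apply: (@L1_bounded _ _ _ _ _ (2 * M * p ^+ n)) => //.
  apply: measurable_funM; first apply: measurable_funM => //.
    exact: (measurable_survives_indic _ _ _ _ (mYn n)).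
  under eq_fun do rewrite profile_split.
  apply: measurable_funD.
    exact: (measurable_profile_plus _ _ _ _ _ (mYn n)).
  exact: (measurable_profile_minus _ _ _ _ _ (mYn n)).
pose tail w := \sum_(k < n) (expR ((s + c) * Y k w) + expR (- (s + c) * Y k w)).
pose E := expR ((s + c) ^+ 2 * h / 2).
have tailE : L1 P tail /\ \int[P]_w tail w = n%:R * (2 * E).
  have i1 k e : L1 P (fun w => expR (e * Y k w)) by exact: (L1_expY P Y h).
  have i2 k : L1 P (fun w => expR ((s + c) * Y k w) + expR (- (s + c) * Y k w)).
    exact: L1D.
  split.
    apply: (L1_sum P n
      (fun k w => expR ((s + c) * Y k w) + expR (- (s + c) * Y k w))) => k _.
    exact: i2.
  rewrite (Rintegral_sum P n
    (fun k w => expR ((s + c) * Y k w) + expR (- (s + c) * Y k w)))//.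
  rewrite (eq_bigr (fun=> 2 * E)); last first.
    move=> k _; rewrite RintegralD// !(Rintegral_expY P Y h)// sqrrN -/E.
    by rewrite mulr_natl mulr2n.
  by rewrite sumr_const card_ord -[LHS]mulr_natl.
have [L1tail ItailE] := tailE.
pose S w := \sum_(j < n) p ^+ j.+1 * ex j w.
have L1S : L1 P S.
  by apply: (L1_sum P n (fun j w => p ^+ j.+1 * ex j w)) => j _; exact: L1Z.
have SE : \int[P]_w S w = \sum_(j < n) p ^+ j.+1 * \int[P]_w ex j w.
  rewrite (Rintegral_sum P n (fun j w => p ^+ j.+1 * ex j w)); last first.
    by move=> j _; exact: L1Z.
  by apply: eq_bigr => j _; rewrite RintegralZl.
pose incs w := \sum_(k < n) inc k w.
have L1incs : L1 P incs.
  by apply: (L1_sum P n inc) => k _; have [] := inc0 k.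
have Iincs : \int[P]_w incs w = 0.
  rewrite (Rintegral_sum P n inc); last by move=> k _; have [] := inc0 k.
  by rewrite big1// => k _; have [] := inc0 k.
pose D w := (last w + S w) - profile s alpha beta 0 0 - incs w.
have Derr w : `|D w| <= K * eta + K * expR (- (c * eta)) * tail w.
  have := err p (xi w) n eta c p0 p1 eta0 eta1 c0.
  have -> : tail w = \sum_(k < n) (expR ((s + c) * xi w k) +
      expR (- ((s + c) * xi w k))).
    by apply: eq_bigr => k _; rewrite mulNr.
  rewrite mulrDr mulrA; apply: le_trans; rewrite le_eqVlt; apply/orP; left; apply/eqP.
  rewrite /D /stopped_value /S; congr (`| _ + _ - _ - _|).
  by apply: eq_bigr => j _; rewrite mulrC.
have L1last_S : L1 P (fun w => last w + S w) by exact: L1D.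
have L1D' : L1 P D.
  apply: L1B => //; apply: L1B => //; exact: L1_cst.
have ID : \int[P]_w D w = \int[P]_w last w + \int[P]_w S w - profile s alpha beta 0 0.
  rewrite RintegralB//; last by apply: L1B => //; exact: L1_cst.
  rewrite RintegralB//; last exact: L1_cst.
  by rewrite RintegralD// Rintegral_prob_cst Iincs subr0.
have Dle : `|\int[P]_w D w| <= K * eta + K * expR (- (c * eta)) * (n%:R * (2 * E)).
  apply: (le_trans (le_normr_Rintegral measurableT L1D')).
  rewrite -ItailE -[X in X + _](Rintegral_prob_cst P) -RintegralZl//.
  rewrite -RintegralD//; [|exact: L1_cst|exact: L1Z].
  apply: le_Rintegral => //; last first.
    by apply: L1D; [exact: L1_cst|exact: L1Z].
  have := integrable_norm L1D'; exact.
have lastle : `|\int[P]_w last w| <= 2 * M * p ^+ n.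
  apply: (le_trans (le_normr_Rintegral measurableT L1last)).
  rewrite -[leRHS](Rintegral_prob_cst P).
  apply: le_Rintegral => //; last exact: L1_cst.
  have := integrable_norm L1last; exact.
rewrite -SE.
have -> : \int[P]_w S w - profile s alpha beta 0 0 =
    \int[P]_w D w - \int[P]_w last w by rewrite ID; ring.
apply: (le_trans (ler_normB _ _)); apply: (le_trans (lerD Dle lastle)).
rewrite -/E.
have T0 : 0 <= expR (- (c * eta)) * (n%:R * (2 * E)).
  by rewrite !mulr_ge0 ?expR_ge0.
have pn0 := exprn_ge0 n p0.
have h1 : 0 <= M * eta by exact: mulr_ge0.
have h2 : 0 <= M * (expR (- (c * eta)) * (n%:R * (2 * E))) by exact: mulr_ge0.
have h3 : 0 <= K * p ^+ n by exact: mulr_ge0.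
move: T0 h1 h2 h3; set e := expR (- (c * eta)); set N := n%:R * (2 * E).
by clear; lra.
Qed.

(** * Sampling a path on a grid *)

Section grid_path.
Context {R : realType}.
Implicit Types (q : nat -> R) (c alpha beta : R).

(** The threshold must vary in the induction: the last increment is moved into it. *)
Lemma reflected_lt q c n :
  reflected (fun k => q k.+1 - q k) n < c <->
  forall i, (i <= n)%N -> q n - q i < c.
Proof.
elim: n c => [|n IH] c /=.
  split=> [c0 i|/(_ 0%N (leqnn _))]; last by rewrite subrr.
  by rewrite leqn0 => /eqP ->; rewrite subrr.
rewrite gt_max; split=> [/andP[h c0] i|h].
  rewrite leq_eqVlt => /predU1P[->|]; first by rewrite subrr.
  rewrite ltnS => iN; have /IH/(_ i iN) : reflected (fun k => q k.+1 - q k) n <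
    c - (q n.+1 - q n) by rewrite ltrBrDr.
  by lra.
have c0 : 0 < c by have := h n.+1 (leqnn _); rewrite subrr.
rewrite c0 andbT -ltrBrDr; apply/IH => i iN.
by have := h i (leq_trans iN (leqnSn _)); lra.
Qed.

Lemma survives_grid q alpha beta n : 0 < alpha -> 0 < beta ->
  survives alpha beta (fun k => q k.+1 - q k) n <->
  forall i j, (i <= j)%N -> (j <= n)%N -> q j - q i < alpha /\ q i - q j < beta.
Proof.
move=> alpha0 beta0.
set xi := fun k => q k.+1 - q k.
have downE m : reflected (fun k => - xi k) m =
    reflected (fun k => - q k.+1 - - q k) m.
  by congr reflected; apply/funext => k; rewrite /xi opprB opprK addrC.
elim: n => [|n IH].
  split=> // _ i j ij; rewrite leqn0 => /eqP j0; move: ij.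
  by rewrite j0 leqn0 => /eqP ->; rewrite subrr.
have -> : survives alpha beta xi n.+1 = survives alpha beta xi n &&
    ((reflected xi n.+1 < alpha) && (reflected (fun k => - xi k) n.+1 < beta)).
  by [].
rewrite downE; split=> [/andP[/IH h /andP[/reflected_lt up down]]|h].
  have {}down := (reflected_lt (fun k => - q k) _ _).1 down.
  move=> i j ij; rewrite leq_eqVlt => /predU1P[jE|]; last first.
    by rewrite ltnS; exact: h.
  rewrite jE; split; first by apply: up; rewrite -jE.
  by have := down i; rewrite opprK addrC; apply; rewrite -jE.
apply/andP; split; first by apply/IH => i j ij jn; apply: h => //; exact: leqW.
apply/andP; split.
  by apply/reflected_lt => i iN; have [] := h i n.+1 iN (leqnn _).
apply/(reflected_lt (fun k => - q k)) => i iN.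
by rewrite opprK addrC; have [] := h i n.+1 iN (leqnn _).
Qed.

Lemma survives_le alpha beta (xi : nat -> R) m n : (m <= n)%N ->
  survives alpha beta xi n -> survives alpha beta xi m.
Proof.
elim: n => [|n IH]; first by rewrite leqn0 => /eqP ->.
rewrite leq_eqVlt => /predU1P[->//|]; rewrite ltnS => mn.
by move=> /= /andP[/(IH mn)].
Qed.

Lemma exits_uniq alpha beta (xi : nat -> R) i j :
  exits alpha beta xi i -> exits alpha beta xi j -> i = j.
Proof.
move=> /andP[si nsi] /andP[sj nsj]; apply/eqP; rewrite eqn_leq.
apply/andP; split; rewrite leqNgt; apply/negP => ij.
  by move/negP: nsj; apply; exact: survives_le si.
by move/negP: nsi; apply; exact: survives_le sj.
Qed.

Lemma exists_exits alpha beta (xi : nat -> R) k :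
  ~~ survives alpha beta xi k ->
  exists2 j, (j < k)%N & exits alpha beta xi j.
Proof.
elim: k => // k IH nsk.
case: (boolP (survives alpha beta xi k)) => sk; last first.
  by have [j jk ej] := IH sk; exists j => //; exact: ltnW.
by exists k => //; rewrite /exits sk.
Qed.

End grid_path.

(** * Exit before an independent exponential time *)

Section exit_probability.
Context {d} {Omega : measurableType d} {R : realType}.
Variables (P : probability Omega R) (G : set (set Omega)).
Variables (Y : nat -> Omega -> R) (T : Omega -> R) (lambda alpha beta h : R).
Hypothesis sGm : <<s G >> `<=` measurable.
Hypothesis mYG : forall k,
  measurable_fun setT (Y k : g_sigma_algebraType G -> R).
Hypothesis mT : measurable_fun setT T.
Hypothesis T_exp : forall A t, <<s G >> A -> 0 <= t ->
  P ([set w | t <= T w] `&` A) = ((expR (- (lambda * t)))%:E * P A)%E.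
Hypothesis h0 : 0 <= h.

Definition exit_event j := [set w | exits alpha beta (fun k => Y k w) j].

Definition exit_before n := [set w | exists j : nat,
  [/\ (j < n)%N, exits alpha beta (fun k => Y k w) j & j.+1%:R * h <= T w]].

Let exit_event_G j : <<s G >> (exit_event j).
Proof.
have mex : measurable_fun setT ((fun w =>
    exits alpha beta (fun k => Y k w) j) : g_sigma_algebraType G -> bool).
  rewrite /exits; apply: measurable_and; last apply: measurable_neg.
    exact: (measurable_survives _ _ _ j).
  exact: (measurable_survives _ _ _ j.+1).
by have := mex measurableT [set true] I; rewrite setTI; exact.
Qed.

Let measurable_T_ge t : measurable [set w | t <= T w].
Proof.
have := mT measurableT `[t, +oo[%classic (measurable_itv _).
by rewrite setTI; congr measurable; apply/seteqP; split=> w /=;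
  rewrite in_itv/= andbT.
Qed.

Let F j := [set w | j.+1%:R * h <= T w] `&` exit_event j.

Let mF j : measurable (F j).
Proof. by apply: measurableI => //; exact: sGm. Qed.

Let exit_beforeE n : exit_before n = \big[setU/set0]_(j < n) F j.
Proof.
rewrite -bigcup_mkord; apply/seteqP; split=> [w [j [jn ej jT]]|w [j jn [jT ej]]].
  by exists j.
by exists j.
Qed.

Lemma measurable_exit_before n : measurable (exit_before n).
Proof. by rewrite exit_beforeE; exact: bigsetU_measurable. Qed.

(** Discounting is killing: the exit events are disjoint and independent of [T], and [T] exceeds
    [j.+1] steps with probability [expR (- (lambda * h)) ^+ j.+1]. *)
Lemma exit_before_probability n : P (exit_before n) =
  (\sum_(j < n) expR (- (lambda * h)) ^+ j.+1 *
     \int[P]_w (exits alpha beta (fun k => Y k w) j)%:R)%:E.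
Proof.
rewrite exit_beforeE measure_bigsetU//; last first.
  by apply: ltn_trivIset => i j ij; rewrite -subset0 => w [[_ ei] [_ ej]];
    move: ij; rewrite (exits_uniq _ _ _ _ _ ei ej) ltnn.
rewrite -sumEFin; apply: eq_bigr => j _.
transitivity ((expR (- (lambda * (j.+1%:R * h))))%:E * P (exit_event j))%E.
  by apply: T_exp => //; rewrite mulr_ge0.
have -> : expR (- (lambda * (j.+1%:R * h))) = expR (- (lambda * h)) ^+ j.+1.
  by rewrite -expRM_natl; congr expR; ring.
have -> : \int[P]_w (exits alpha beta (fun k => Y k w) j)%:R =
    fine (P (exit_event j)).
  rewrite /Rintegral -[in RHS](setIT (exit_event j)) -integral_indic//;
    last exact: sGm.
  by congr fine; apply: eq_integral => w _; rewrite indicE mem_setE.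
by rewrite EFinM fineK// fin_num_measure//; exact: sGm.
Qed.

End exit_probability.

Lemma exponential_prob_itvcy {R : realType} (lambda t : R) :
  0 < lambda -> 0 <= t ->
  exponential_prob lambda `[t, +oo[ = (expR (- (lambda * t)))%:E.
Proof.
move=> l0 t0; rewrite /exponential_prob.
rewrite (@ge0_continuous_FTC2y _ _ (fun x => - expR (- lambda * x)) _ 0)//.
- by rewrite EFinN oppeK add0e mulNr.
- by move=> x _; apply: exponential_pdf_ge0; exact: ltW.
- apply: (@continuous_subspaceW R^o _ _ [set` `[0, +oo[%R]).
    by move=> x /=; rewrite !in_itv/= !andbT; exact: le_trans.
  exact: within_continuous_exponential_pdf.
- rewrite -oppr0; apply: cvgN.
  rewrite (_ : (fun x => expR (- lambda * x)) =
               (fun z => expR (- z)) \o (fun z => lambda * z)); last first.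
    by apply: eq_fun => x; rewrite mulNr.
  apply: (@cvg_comp _ _ _ _ _ _ (pinfty_nbhs R)); last exact: cvgr_expR.
  exact: gt0_cvgMry.
- apply: cvgN; apply/cvg_at_right_filter.
  apply: continuous_comp; last exact: continuous_expR.
  by apply: continuousM => //; exact: cst_continuous.
- move=> x; rewrite in_itv/= andbT => tx.
  by apply: derive1_exponential_pdf; rewrite in_itv/= andbT (le_lt_trans t0).
Qed.

(* The mesh is Q^-4 and the horizon Q with Q = q.+1: increments above Q^-1 are
   then super-exponentially rare in the Q^5 steps. *)
Definition grid_step {R : realType} q : R := (q.+1%:R ^+ 4)^-1.

Definition grid_horizon q : nat := (q.+1 ^ 5)%N.

(** * Rate of convergence as the mesh shrinks *)

Section exit_limit.
Context {R : realType}.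
Implicit Types (lambda alpha beta s : R).

Lemma grid_step_gt0 q : 0 < grid_step q :> R.
Proof. by rewrite invr_gt0 exprn_gt0. Qed.

Lemma grid_step_horizon q : (grid_horizon q)%:R * grid_step q = q.+1%:R :> R.
Proof.
rewrite /grid_horizon /grid_step natrX [_ ^+ 5]exprS mulfK// expf_neq0.

Qed.

(** From the term of degree 6 of the exponential series; the power 5 is that of the number of
    steps. *)
Lemma exp_pow5_bound : exists2 F : R, 0 < F &
  forall Q : R, 0 < Q -> expR (- Q) * Q ^+ 5 <= F / Q.
Proof.
have F0 : 0 < 6`!%:R :> R by rewrite ltr0n fact_gt0.
exists 6`!%:R => // Q Q0; have := expR_ge1Dxn 5 (ltW Q0).
move: (6`!%:R : R) F0 => F F0 e3.
have {}e3 : Q ^+ 6 / F <= expR Q by apply: le_trans e3; rewrite lerDr.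
rewrite expRN ler_pdivlMr// -mulrA -exprSr ler_pdivrMl ?expR_gt0//.
by move: e3; rewrite ler_pdivrMr.
Qed.

(** The choice is [eta = Q^-1] and [c = Q ^+ 2] with mesh [Q ^- 4]: [c * eta = Q] beats the [Q ^+ 5]
    steps, while [(s + c) ^+ 2] times the mesh stays bounded. *)
Lemma error_rate (lambda s K : R) : 0 < lambda -> 0 <= s -> 0 <= K ->
  exists C : R, forall Q, 1 <= Q ->
  K * (Q^-1 + expR (- (Q ^+ 2 * Q^-1)) *
    (Q ^+ 5 * (2 * expR ((s + Q ^+ 2) ^+ 2 * (Q ^+ 4)^-1 / 2))) +
    expR (- (lambda * Q))) <= C / Q.
Proof.
move=> l0 s0 K0; have [F F0 bound] := exp_pow5_bound.
exists (K * (1 + F * (2 * expR ((s + 1) ^+ 2 / 2)) + lambda^-1)) => Q Q1.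
have Q0 : 0 < Q by exact: lt_le_trans Q1.
have QN0 : Q != 0 by rewrite gt_eqF.
rewrite -[leRHS]mulrA; apply: ler_wpM2l => //; rewrite [leRHS]mulrDl.
rewrite [X in _ <= X + _]mulrDl mul1r.
have e1 : expR ((s + Q ^+ 2) ^+ 2 * (Q ^+ 4)^-1 / 2) <= expR ((s + 1) ^+ 2 / 2).
  rewrite ler_expR ler_pM2r ?invr_gt0// ler_pdivrMr ?exprn_gt0//.
  have -> : (s + 1) ^+ 2 * Q ^+ 4 = ((s + 1) * Q ^+ 2) ^+ 2.
    by rewrite exprMn -exprM.
  have q1 : 1 <= Q ^+ 2 by rewrite exprn_ege1.
  have p1 : 0 <= s + Q ^+ 2 by rewrite addr_ge0// sqr_ge0.
  have p2 : 0 <= (s + 1) * Q ^+ 2 by rewrite mulr_ge0 ?sqr_ge0// addr_ge0.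
  by rewrite ler_sqr// mulrDl mul1r lerD2r ler_peMr.
have E0 := expR_ge0 ((s + Q ^+ 2) ^+ 2 * (Q ^+ 4)^-1 / 2).
move: e1 E0; set E := expR (_ * _ / 2); set E' := expR (_ / 2) => EE' E0.
apply: lerD; first apply: lerD => //.
- rewrite expr2 mulfK// [leLHS]mulrA (mulrAC F).
  apply: ler_pM; [|by rewrite mulr_ge0|exact: bound|by rewrite ler_pM2l].
  by rewrite mulr_ge0 ?expR_ge0 ?exprn_ge0// ltW.
- rewrite expRN -invfM lef_pV2 ?posrE ?expR_gt0 ?mulr_gt0//.
  have := expR_ge1Dx (lambda * Q); apply: le_trans.
  by rewrite lerDr.
Qed.

Lemma exit_before_rate s lambda alpha beta :
  0 < s -> s ^+ 2 = 2 * lambda -> 0 < alpha -> alpha <= beta ->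
  exists C : R, forall d (Omega : measurableType d) (P : probability Omega R)
    (G : set (set Omega)) (Y : nat -> Omega -> R) (T : Omega -> R) (q : nat),
  <<s G >> `<=` measurable ->
  (forall k, measurable_fun setT (Y k : g_sigma_algebraType G -> R)) ->
  measurable_fun setT T ->
  (forall A t, <<s G >> A -> 0 <= t ->
    P ([set w | t <= T w] `&` A) = ((expR (- (lambda * t)))%:E * P A)%E) ->
  (forall n, mutually_independent P (fun i : 'I_n => Y i)) ->
  (forall k c, (\int[P]_w (expR (c * Y k w))%:E =
     (expR (c ^+ 2 * grid_step q / 2))%:E)%E) ->
  `|fine (P (exit_before Y T alpha beta (grid_step q) (grid_horizon q))) -
    profile s alpha beta 0 0| <= C / q.+1%:R.
Proof.
move=> s0 s2 alpha0 ab.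
have [K K0 est] := expected_exit s alpha beta s0 alpha0 ab.
have l0 : 0 < lambda by have := exprn_gt0 2 s0; rewrite s2; lra.
have [C rate] := error_rate lambda s K l0 (ltW s0) K0; exists C.
move=> d Omega P G Y T q sGm mYG mT T_exp Yindep Ymgf.
have mY k : measurable_fun setT (Y k).
  by move=> _ B mB; apply: sGm; exact: mYG.
set Q : R := q.+1%:R.
have Q1 : 1 <= Q by rewrite ler1n.
have Q0 : 0 < Q by exact: lt_le_trans Q1.
have h0 : 0 <= grid_step q :> R by exact/ltW/grid_step_gt0.
rewrite (exit_before_probability P G Y T lambda alpha beta)//=.
have := est d Omega P Y (grid_step q) (expR (- (lambda * grid_step q)))
  Q^-1 (Q ^+ 2) (grid_horizon q) mY Yindep Ymgf.
move=> /(_ (expR_ge0 _)).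
rewrite -[X in _ <= X -> _]expR0 ler_expR oppr_le0 mulr_ge0 ?(ltW l0)// => /(_ isT).
rewrite -expRD s2.
(* Here [s ^+ 2 = 2 * lambda] makes killing offset the exponential moment exactly. *)
have -> : - (lambda * grid_step q) + 2 * lambda * grid_step q / 2 = 0 :> R by field.
rewrite expR0 => /(_ erefl).
rewrite invr_ge0 (ltW Q0) invf_le1// Q1 exprn_ge0 ?(ltW Q0)//.
move=> /(_ isT isT isT) /le_trans; apply.
rewrite -expRM_natl mulrN (mulrCA _ lambda) grid_step_horizon -/Q natrX -/Q.
exact: rate.
Qed.

End exit_limit.

(** * Extremes of a continuous path and of its grid values *)

Section extremes.
Context {R : realType}.
Implicit Types (f : R -> R) (t u v c : R).

Lemma max_decreaseE f t : max_decrease f t = max_increase (fun x => - f x) t.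
Proof.
congr sup; apply/seteqP; split=> [r [u [v [u0 uv vt ->]]]|r [u [v [u0 uv vt ->]]]];
  by exists u, v; split=> //; ring.
Qed.

Lemma max_increase_ge f t u v : {within `[0, +oo[, continuous f} ->
  0 <= u -> u <= v -> v <= t -> f v - f u <= max_increase f t.
Proof.
move=> cf u0 uv vt; have t0 : 0 <= t by exact: le_trans u0 (le_trans uv vt).
have cft : {within `[0, t], continuous f}.
  by apply: (@continuous_subspaceW R^o _ _ [set` `[0, +oo[%R]) => //;
     exact: subset_itvl.
have [c _ fc] := EVT_max t0 cft; have [c' _ fc'] := EVT_min t0 cft.
apply: ub_le_sup; last by exists u, v; split.
exists (f c - f c') => r [u' [v' [u'0 uv' vt' ->]]].
apply: lerB; [apply: fc|apply: fc']; rewrite in_itv/=.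
  by rewrite vt' andbT (le_trans u'0).
by rewrite u'0 (le_trans uv').
Qed.

(** For [t < 0] the set is empty and its [sup] is 0 by default; [0 <= c] excludes this case. *)
Lemma max_increase_gt f t c : 0 <= c -> c < max_increase f t ->
  exists u v, [/\ 0 <= u, u <= v, v <= t & c < f v - f u].
Proof.
rewrite /max_increase; set A := [set r | _] => c0 cA.
have A0 : A !=set0.
  apply/set0P/eqP => A0; move: cA; rewrite A0 sup0 => /(le_lt_trans c0).
  by rewrite ltxx.
have [r [u [v [u0 uv vt ->]]] cr] := sup_gt A0 cA.
by exists u, v.
Qed.

Lemma grid_step_cvg (e : R) : 0 < e ->
  exists N, forall q, (N <= q)%N -> grid_step q < e.
Proof.
move=> e0; exists (Num.truncn e^-1) => q Nq.
have Q1 : 1 <= q.+1%:R :> R by rewrite ler1n.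
have Q0 : 0 < q.+1%:R :> R by rewrite ltr0n.
rewrite /grid_step -[e]invrK ltf_pV2 ?posrE ?invr_gt0 ?exprn_gt0//.
apply: lt_le_trans (_ : q.+1%:R <= _).
  by apply: (lt_le_trans (truncnS_gt _)); rewrite ler_nat.
by rewrite exprS ler_peMr ?exprn_ege1// ltW.
Qed.

Lemma within_continuous_eps f u (e : R) : {within `[0, +oo[, continuous f} ->
  0 <= u -> 0 < e ->
  exists2 dl : R, 0 < dl & forall y, 0 <= y -> `|u - y| < dl -> `|f u - f y| < e.
Proof.
move=> /subspace_continuousP cf u0 e0.
have cu : `[0, +oo[%classic u by rewrite /= in_itv/= u0.
have := cf u cu; move/cvgrPdist_lt => /(_ e e0).
rewrite near_withinE => /nbhs_ballP[dl /= dl0 dlP]; exists dl => // y y0 uy.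
by apply: dlP => //=; rewrite in_itv/= y0.
Qed.

(** Both times are rounded down, which preserves their order and keeps the later one at most [t]. *)
Lemma grid_exceeds f t u v c : {within `[0, +oo[, continuous f} ->
  0 <= u -> u <= v -> v <= t -> c < f v - f u ->
  exists N, forall q, (N <= q)%N -> exists i j, [/\ (i <= j)%N,
    j%:R * grid_step q <= t &
    c < f (j%:R * grid_step q) - f (i%:R * grid_step q)].
Proof.
move=> cf u0 uv vt cuv; have v0 := le_trans u0 uv.
(* Each endpoint may spend half of the slack. *)
pose e := (f v - f u - c) / 2.
have e0 : 0 < e by rewrite /e; lra.
have [d1 d10 H1] := within_continuous_eps f u e cf u0 e0.
have [d2 d20 H2] := within_continuous_eps f v e cf v0 e0.
have [N1 h1] := grid_step_cvg d1 d10; have [N2 h2] := grid_step_cvg d2 d20.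
exists (maxn N1 N2) => q; rewrite geq_max => /andP[/h1 q1 /h2 q2].
have g0 := grid_step_gt0 q : 0 < grid_step q :> R.
have near_grid (x : R) : 0 <= x ->
    let y := (Num.truncn (x / grid_step q))%:R * grid_step q in
    [/\ 0 <= y, y <= x & `|x - y| <= grid_step q].
  move=> x0 y; have xg0 : 0 <= x / grid_step q := divr_ge0 x0 (ltW g0).
  have /andP[l1 l2] := truncn_itv xg0.
  have y1 : y <= x by rewrite /y -ler_pdivlMr.
  split; [exact: mulr_ge0 (ler0n _ _) (ltW g0)|exact: y1|].
  rewrite ger0_norm ?subr_ge0// lerBlDr -[X in X + _]mul1r -mulrDl.
  by rewrite -ler_pdivrMr// nat1r ltW.
have [yu0 yu1 yu2] := near_grid u u0; have [yv0 yv1 yv2] := near_grid v v0.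
exists (Num.truncn (u / grid_step q)), (Num.truncn (v / grid_step q)); split.
- by apply: le_truncn; rewrite ler_pM2r ?invr_gt0.
- exact: le_trans vt.
- have := H1 _ yu0 (le_lt_trans yu2 q1); have := H2 _ yv0 (le_lt_trans yv2 q2).
  rewrite !ltr_norml /e => /andP[] ? ? /andP[] ? ?; lra.
Qed.

End extremes.

Section exit_events.
Context {R : realType}.
Implicit Types (f : R -> R) (t alpha beta : R).

Definition grid_increment f q k : R :=
  f (k.+1%:R * grid_step q) - f (k%:R * grid_step q).

Definition exits_before f t alpha beta q := exists j : nat,
  [/\ (j < grid_horizon q)%N, exits alpha beta (grid_increment f q) j &
      j.+1%:R * grid_step q <= t].

Lemma exits_before_extremes f t alpha beta q : 0 < alpha -> 0 < beta ->
  {within `[0, +oo[, continuous f} -> exits_before f t alpha beta q ->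
  alpha <= max_increase f t \/ beta <= max_decrease f t.
Proof.
move=> alpha0 beta0 cf [j [_ /andP[_ /negP nsv] jt]].
apply/orP; apply: contraT; rewrite negb_or -!ltNge => /andP[up down].
exfalso; apply: nsv.
apply/(survives_grid (fun k => f (k%:R * grid_step q)) alpha beta j.+1 alpha0 beta0).
move=> i k ik kj.
have g0 := grid_step_gt0 q : 0 < grid_step q :> R.
have i0 : 0 <= i%:R * (grid_step q : R) := mulr_ge0 (ler0n _ _) (ltW g0).
have ik' : i%:R * (grid_step q : R) <= k%:R * grid_step q.
  by rewrite ler_pM2r// ler_nat.
have kt : k%:R * grid_step q <= t.
  by apply: le_trans jt; rewrite ler_pM2r// ler_nat.
split; first exact: le_lt_trans (max_increase_ge f t _ _ cf i0 ik' kt) up.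
apply: le_lt_trans down; rewrite max_decreaseE.
have cNf : {within `[0, +oo[, continuous (fun x => - f x)}.
  by move=> x; apply: cvgN; exact: cf.
have := max_increase_ge (fun x => - f x) t _ _ cNf i0 ik' kt.
by rewrite opprK addrC.
Qed.

(** Strict excess is visible on every fine enough grid; excess with equality may be missed by all of
    them. *)
Lemma extremes_exits_before f t alpha beta : 0 < alpha -> 0 < beta ->
  {within `[0, +oo[, continuous f} ->
  alpha < max_increase f t \/ beta < max_decrease f t ->
  exists N, forall q, (N <= q)%N -> exits_before f t alpha beta q.
Proof.
move=> alpha0 beta0 cf ext.
have [N gridN] : exists N, forall q, (N <= q)%N -> exists i j, [/\ (i <= j)%N,
    j%:R * grid_step q <= t &
    alpha < f (j%:R * grid_step q) - f (i%:R * grid_step q) \/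
    beta < f (i%:R * grid_step q) - f (j%:R * grid_step q)].
  case: ext => [up|].
    have [u [v [u0 uv vt cuv]]] := max_increase_gt f t alpha (ltW alpha0) up.
    have [N H] := grid_exceeds f t u v alpha cf u0 uv vt cuv.
    exists N => q /H[i [j [ij jt lt]]]; exists i, j; split=> //; by left.
  rewrite max_decreaseE => down.
  have cNf : {within `[0, +oo[, continuous (fun x => - f x)}.
    by move=> x; apply: cvgN; exact: cf.
  have [u [v [u0 uv vt cuv]]] := max_increase_gt _ t beta (ltW beta0) down.
  have [N H] := grid_exceeds _ t u v beta cNf u0 uv vt cuv.
  exists N => q /H[i [j [ij jt lt]]]; exists i, j; split=> //; right.
  by move: lt; rewrite opprK addrC.
(* The bound [Num.truncn t] puts the horizon [q.+1] beyond [t]. *)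
exists (maxn N (Num.truncn t)) => q; rewrite geq_max => /andP[/gridN + tq].
move=> [i [j [ij jt lt]]].
have g0 := grid_step_gt0 q : 0 < grid_step q :> R.
have nsv : ~~ survives alpha beta (grid_increment f q) j.
  apply/negP => /(survives_grid (fun k => f (k%:R * grid_step q)) alpha beta
    j alpha0 beta0)/(_ i j ij (leqnn _))[h1 h2].
  by case: lt => /lt_trans; [move=> /(_ _ h1)|move=> /(_ _ h2)]; rewrite ltxx.
have [k kj ek] := exists_exits _ _ _ _ nsv.
have kt : k.+1%:R * grid_step q <= t.
  by apply: le_trans jt; rewrite ler_pM2r// ler_nat.
exists k; split=> //.
have : t < q.+1%:R by apply: lt_le_trans (truncnS_gt _) _; rewrite ler_nat.
rewrite -grid_step_horizon => /(le_lt_trans kt).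
by rewrite ltr_pM2r// ltr_nat; exact: ltnW.
Qed.

End exit_events.

(** * Limits of the formulas *)

Section formula_limits.
Context {R : realType}.
Implicit Types lambda alpha beta x e : R.

Lemma continuous_cosh : continuous (@cosh R).
Proof.
move=> x; rewrite /cosh; apply: cvgM; last exact: cvg_cst.
apply: cvgD; first exact: continuous_expR.
by apply: continuous_comp; [exact: opp_continuous|exact: continuous_expR].
Qed.

Lemma continuous_sinh : continuous (@sinh R).
Proof.
move=> x; rewrite /sinh; apply: cvgM; last exact: cvg_cst.
apply: cvgB; first exact: continuous_expR.
by apply: continuous_comp; [exact: opp_continuous|exact: continuous_expR].
Qed.

Lemma v_fun_ge0 lambda alpha beta : 0 <= v_fun lambda alpha beta.
Proof.
rewrite /v_fun; set c := cosh _; have c1 : 1 <= c := cosh_ge1 _.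
have c0 : 0 <= c by exact: le_trans c1.
apply: divr_ge0; first by rewrite mulr_ge0 ?expR_ge0 ?subr_ge0.
by apply: mulr_ge0 => //; rewrite addr_ge0.
Qed.

(** Since [exp (- y) <= 1 / y], the decay is at least harmonic, the form that [le_of_harmonic_error]
    takes. *)
Lemma v_fun_decay lambda alpha beta :
  0 < lambda -> 0 < alpha -> alpha <= beta ->
  exists C : R, forall q : nat, v_fun lambda alpha (beta + q.+1%:R) <= C / q.+1%:R.
Proof.
move=> l0 alpha0 ab; set s := Num.sqrt (2 * lambda).
have s0 : 0 < s by rewrite sqrtr_gt0 mulr_gt0.
have as0 : 0 < alpha * s by rewrite mulr_gt0.
pose k := s * coth (alpha * s).
have k0 : 0 < k := mulr_gt0 s0 (divr_gt0 (cosh_gt0 _) (sinh_gt0 _ as0)).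
exists k^-1 => q.
have Q0 : 0 < q.+1%:R :> R by rewrite ltr0n.
rewrite /v_fun -/s; set c := cosh _; have c1 : 1 <= c := cosh_ge1 _.
have c0 : 0 < c by exact: lt_le_trans c1.
set E := expR _.
have E0 : 0 <= E by exact: expR_ge0.
apply: (@le_trans _ _ E).
  rewrite ler_pdivrMr; last by rewrite mulr_gt0// addr_gt0.
  rewrite mulrC; apply: ler_wpM2l => //.
  have : c <= c * (c + 1) by rewrite ler_peMr ?(ltW c0)// lerDr (ltW c0).
  by clear; lra.
have Qk0 : 0 < k * q.+1%:R by rewrite mulr_gt0.
have gap : q.+1%:R <= beta + q.+1%:R - alpha.
  by rewrite addrAC lerDr subr_ge0.
rewrite /E expRN -invfM lef_pV2 ?posrE ?expR_gt0// -mulrA -/k.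
have := expR_ge1Dx ((beta + q.+1%:R - alpha) * k); apply: le_trans.
apply: (@le_trans _ _ ((beta + q.+1%:R - alpha) * k)); last by rewrite lerDr.
by rewrite mulrC ler_pM2r.
Qed.

(** Both levels move by the same amount, which preserves their order and leaves [beta - alpha] in
    the exponent unchanged. *)
Lemma u_fun_shift lambda alpha beta e : 0 < lambda -> 0 < alpha -> 0 < e ->
  exists dl : R, [/\ 0 < dl, dl < alpha,
    `|u_fun lambda alpha beta - u_fun lambda (alpha + dl) (beta + dl)| < e &
    `|u_fun lambda alpha beta - u_fun lambda (alpha - dl) (beta - dl)| < e].
Proof.
move=> l0 alpha0 e0; set s := Num.sqrt (2 * lambda).
have s0 : 0 < s by rewrite sqrtr_gt0 mulr_gt0.
have as0 : 0 < alpha * s by rewrite mulr_gt0.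
pose f x := u_fun lambda (alpha + x) (beta + x).
have arg : (alpha + x) * s @[x --> (0 : R)] --> alpha * s.
  apply: cvgM; last exact: cvg_cst.
  rewrite -[X in _ --> X]addr0; apply: cvgD; [exact: cvg_cst|exact: cvg_id].
have cC : cosh ((alpha + x) * s) @[x --> (0 : R)] --> cosh (alpha * s).
  exact: (continuous_cvg _ (continuous_cosh _) arg).
have cS : sinh ((alpha + x) * s) @[x --> (0 : R)] --> sinh (alpha * s).
  exact: (continuous_cvg _ (continuous_sinh _) arg).
have CN : cosh (alpha * s) != 0 by rewrite gt_eqF// cosh_gt0.
have SN : sinh (alpha * s) != 0 by rewrite gt_eqF// sinh_gt0.
have C1N : cosh (alpha * s) + 1 != 0 by rewrite gt_eqF// addr_gt0// cosh_gt0.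
have cf : f x @[x --> (0 : R)] --> u_fun lambda alpha beta.
  rewrite /f /u_fun /v_fun -/s; apply: cvgB.
    by apply: cvgB; [exact: cvg_cst|exact: cvgV].
  apply: cvgM.
    apply: cvgM; first by apply: cvgB => //; exact: cvg_cst.
    apply: (continuous_cvg _ (@continuous_expR R _)); apply: cvgN.
    apply: cvgM; last by rewrite /coth; apply: cvgM => //; exact: cvgV.
    apply: cvgM; last exact: cvg_cst.
    rewrite (_ : (fun x : R => beta + x - (alpha + x)) = cst (beta - alpha)).
      exact: cvg_cst.
    by apply/funext => x /=; ring.
  apply: cvgV; first by rewrite mulf_neq0.
  by apply: cvgM => //; apply: cvgD => //; exact: cvg_cst.
move: cf => /cvgrPdist_lt /(_ e e0) /nbhs_ballP[r /= r0 rP].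
pose dl := Num.min (r / 2) (alpha / 2).
have dl0 : 0 < dl by rewrite lt_min !divr_gt0.
have dlr : dl < r by rewrite gt_min ltr_pdivrMr// mulr_natr mulr2n ltrDl r0.
exists dl; split=> //.
- by rewrite gt_min orbC ltr_pdivrMr// mulr_natr mulr2n ltrDl alpha0.
- by apply: rP; rewrite /ball /= sub0r normrN gtr0_norm.
- by apply: (rP (- dl)); rewrite /ball /= sub0r opprK gtr0_norm.
Qed.

End formula_limits.

(** * From the grid to continuous time *)

Section profile_value.
Context {R : realType}.
Implicit Types lambda alpha beta : R.

Lemma profile_origin lambda alpha beta : 0 < lambda -> 0 < alpha ->
  profile (Num.sqrt (2 * lambda)) alpha beta 0 0 = 1 - u_fun lambda alpha beta.
Proof.
move=> l0 alpha0; set s := Num.sqrt (2 * lambda).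
have s0 : 0 < s by rewrite sqrtr_gt0 mulr_gt0.
rewrite /profile addr0 alpha0 /profile_narrow mulr0 cosh0 !mulr1.
rewrite /u_fun /v_fun /narrow_coef_up /narrow_coef_down /edge_value /wide_coef.
rewrite /rate_up -/s mulrA.
have S0 : 0 < sinh (alpha * s) by rewrite sinh_gt0// mulr_gt0.
have C0 := cosh_gt0 (alpha * s); have CS := cosh2_sinh2 (alpha * s).
move: (coth (alpha * s)) => ct; move: (expR _) => E.
move: (sinh (alpha * s)) (cosh (alpha * s)) S0 C0 CS => S C S0 C0 CS.
have SN : S != 0 by rewrite gt_eqF.
have CN : C != 0 by rewrite gt_eqF.
have C1N : C + 1 != 0 by rewrite gt_eqF// addr_gt0.
have Cm1N : C - 1 != 0.
  apply/eqP => /eqP; rewrite subr_eq0 => /eqP C1; move: CS; rewrite C1 expr1n.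
  by move=> /eqP; rewrite -{1}[1]addr0 (inj_eq (addrI _)) eq_sym sqrf_eq0 (negbTE SN).
(* This factorization produces the factor [C + 1] in the denominator of [v_fun]. *)
have S2 : S ^+ 2 = (C - 1) * (C + 1).
  by rewrite (_ : S ^+ 2 = C ^+ 2 - 1); [ring|rewrite CS; ring].
by rewrite S2; field; rewrite SN CN C1N Cm1N.
Qed.

End profile_value.

Lemma le_of_harmonic_error {R : realType} (x y C : R) :
  (forall q : nat, x <= y + C / q.+1%:R) -> x <= y.
Proof.
move=> h; rewrite leNgt; apply/negP => yx; have d0 : 0 < x - y by rewrite subr_gt0.
pose q := Num.truncn (C / (x - y)).
have := truncnS_gt (C / (x - y)); rewrite -/q ltr_pdivrMr// mulrC => Cq.
have := h q; rewrite -lerBlDl ler_pdivlMr ?ltr0n// => /(lt_le_trans Cq).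
by rewrite ltxx.
Qed.

Section brownian_core.
Context {d} {Omega : measurableType d} {R : realType}.
Variables (P : probability Omega R) (G : set (set Omega)).
Variables (X : R -> Omega -> R) (T : Omega -> R) (lambda : R).
Hypothesis lambda0 : 0 < lambda.
Hypothesis sGm : <<s G >> `<=` measurable.
Hypothesis mXG : forall t, 0 <= t ->
  measurable_fun setT (X t : g_sigma_algebraType G -> R).
Hypothesis mT : measurable_fun setT T.
Hypothesis T_exp : forall A t, <<s G >> A -> 0 <= t ->
  P ([set w | t <= T w] `&` A) = ((expR (- (lambda * t)))%:E * P A)%E.
Hypothesis Xcont : forall w, {within `[0, +oo[, continuous (fun t => X t w)}.
Let Y q k w := grid_increment (fun t => X t w) q k.
Hypothesis Yindep : forall q n, mutually_independent P (fun i : 'I_n => Y q i).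
Hypothesis Ymgf : forall q k c, (\int[P]_w (expR (c * Y q k w))%:E =
  (expR (c ^+ 2 * grid_step q / 2))%:E)%E.

Let Dp w := max_increase (fun t => X t w) (T w).
Let Dm w := max_decrease (fun t => X t w) (T w).
Let pr A := fine (P A).

Let prE A : measurable A -> P A = (pr A)%:E.
Proof. by move=> mA; rewrite fineK// fin_num_measure. Qed.

Let pr_le A B : measurable A -> measurable B -> A `<=` B -> pr A <= pr B.
Proof.
move=> mA mB AB; rewrite -lee_fin -!prE//; apply: le_measure => //; exact/mem_set.
Qed.

Let prC A : measurable A -> pr (~` A) = 1 - pr A.
Proof.
move=> mA; apply: EFin_inj; rewrite -prE; last exact: measurableC.
by rewrite probability_setC// prE.
Qed.

Let mX t : 0 <= t -> measurable_fun setT (X t).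
Proof. by move=> t0 _ B mB; apply: sGm; exact: mXG. Qed.

Let mYG q k : measurable_fun setT (Y q k : g_sigma_algebraType G -> R).
Proof.
have g0 := ltW (grid_step_gt0 q : 0 < grid_step q :> R).
by apply: measurable_funB; apply: mXG; rewrite mulr_ge0 ?ler0n.
Qed.

(** By continuity, exceeding [c] strictly is a countable union of events at pairs of grid times. *)
Lemma measurable_grid_max (Z : R -> Omega -> R) :
  (forall t, 0 <= t -> measurable_fun setT (Z t)) ->
  (forall w, {within `[0, +oo[, continuous (fun t => Z t w)}) ->
  measurable_fun setT (fun w => max_increase (fun t => Z t w) (T w)).
Proof.
move=> mZ Zcont; apply: (measurability _ (RGenOInfty.measurableE R)).
move=> _ [_ [c ->] <-]; rewrite setTI.
(* For [c < 0] the event is everything, even where [T w < 0]: the supremum over the empty set is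
   0. *)
have [c0|c0] := ltP c 0.
  rewrite (_ : _ @^-1` _ = setT)//; apply/seteqP; split=> // w _ /=.
  rewrite in_itv/= andbT; apply: (lt_le_trans c0).
  have [t0|t0] := leP 0 (T w).
    have := max_increase_ge (fun t => Z t w) (T w) _ _ (Zcont w) (lexx 0) t0 (lexx _).
    have := max_increase_ge (fun t => Z t w) (T w) _ _ (Zcont w) (lexx 0) (lexx 0) t0.
    by rewrite subrr.
  rewrite /max_increase (_ : [set r | _] = set0) ?sup0//.
  apply/seteqP; split=> // r [u [v [u0 uv vt _]]].
  by have := le_lt_trans (le_trans u0 (le_trans uv vt)) t0; rewrite ltxx.
have g0 q := grid_step_gt0 q : 0 < grid_step q :> R.
have ig q i : 0 <= i%:R * (grid_step q : R) := mulr_ge0 (ler0n _ _) (ltW (g0 q)).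
rewrite (_ : _ @^-1` _ = \bigcup_q \bigcup_i \bigcup_(j in [set j | (i <= j)%N])
  ([set w | j%:R * grid_step q <= T w] `&`
   [set w | c < Z (j%:R * grid_step q) w - Z (i%:R * grid_step q) w])).
  apply: bigcupT_measurable => q; apply: bigcupT_measurable => i.
  apply: bigcup_measurable => j _; apply: measurableI.
    have := mT measurableT `[j%:R * grid_step q, +oo[%classic (measurable_itv _).
    by rewrite setTI; congr measurable; apply/seteqP; split=> w /=;
      rewrite in_itv/= andbT.
  have mZZ : measurable_fun setT
      (fun w => Z (j%:R * grid_step q) w - Z (i%:R * grid_step q) w).
    by apply: measurable_funB; exact: mZ.
  have := mZZ measurableT `]c, +oo[%classic (measurable_itv _).
  by rewrite setTI; congr measurable; apply/seteqP; split=> w /=;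
    rewrite in_itv/= andbT.
apply/seteqP; split=> w /=; rewrite in_itv/= andbT.
  move=> /(max_increase_gt _ _ _ c0)[u [v [u0 uv vt cuv]]].
  have [N /(_ N (leqnn _))[i [j [ij jt lt]]]] :=
    grid_exceeds _ _ _ _ _ (Zcont w) u0 uv vt cuv.
  by exists N => //; exists i => //; exists j.
move=> [q _ [i _ [j /= ij [jt lt]]]]; apply: (lt_le_trans lt).
apply: (max_increase_ge (fun t => Z t w)) => //.
by rewrite ler_pM2r// ler_nat.
Qed.

Let mDp : measurable_fun setT Dp.
Proof. exact: measurable_grid_max. Qed.

Let mDm : measurable_fun setT Dm.
Proof.
rewrite /Dm; under eq_fun do rewrite max_decreaseE.
apply: (measurable_grid_max (fun t w => - X t w)).
  by move=> t t0; apply: measurableT_comp => //; exact: mX.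
by move=> w x; apply: cvgN; exact: Xcont.
Qed.

Let measurable_lt (f : Omega -> R) c : measurable_fun setT f ->
  measurable [set w | f w < c].
Proof.
move=> mf; have := mf measurableT `]-oo, c[%classic (measurable_itv _).
by rewrite setTI; congr measurable; apply/seteqP; split=> w /=; rewrite in_itv.
Qed.

Let measurable_le (f : Omega -> R) c : measurable_fun setT f ->
  measurable [set w | f w <= c].
Proof.
move=> mf; have := mf measurableT `]-oo, c]%classic (measurable_itv _).
by rewrite setTI; congr measurable; apply/seteqP; split=> w /=; rewrite in_itv.
Qed.

Let below a b := [set w | Dp w < a /\ Dm w < b].
Let below_eq a b := [set w | Dp w <= a /\ Dm w <= b].

Let mbelow a b : measurable (below a b).
Proof. by apply: measurableI; exact: measurable_lt. Qed.

Let mbelow_eq a b : measurable (below_eq a b).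
Proof. by apply: measurableI; exact: measurable_le. Qed.

Section fixed_levels.
Variables alpha beta : R.
Hypotheses (alpha0 : 0 < alpha) (alpha_le_beta : alpha <= beta).

Let Ex q := exit_before (Y q) T alpha beta (grid_step q) (grid_horizon q).

Let mEx q : measurable (Ex q).
Proof. exact: (measurable_exit_before G). Qed.

Let Ex_rate : exists C : R, forall q,
  `|pr (Ex q) - (1 - u_fun lambda alpha beta)| <= C / q.+1%:R.
Proof.
have s0 : 0 < Num.sqrt (2 * lambda) by rewrite sqrtr_gt0 mulr_gt0.
have s2 : Num.sqrt (2 * lambda) ^+ 2 = 2 * lambda.
  by rewrite sqr_sqrtr// mulr_ge0// ltW.
have [C rate] := exit_before_rate _ _ alpha beta s0 s2 alpha0 alpha_le_beta.
exists C => q; rewrite -profile_origin//.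
exact: (rate _ _ P G).
Qed.

Lemma below_le_u : pr (below alpha beta) <= u_fun lambda alpha beta.
Proof.
have beta0 := lt_le_trans alpha0 alpha_le_beta.
have [C rate] := Ex_rate; apply: (le_of_harmonic_error _ _ C) => q.
have : pr (below alpha beta) <= pr (~` Ex q).
  apply: pr_le => //; first exact: measurableC.
  move=> w [up down] ex.
  have := exits_before_extremes (fun t => X t w) (T w) alpha beta q
    alpha0 beta0 (Xcont w) ex.
  by case; rewrite leNgt ?up ?down.
move/le_trans; apply; rewrite prC//.
have := rate q; rewrite ler_norml.
move: (C / _) (pr (Ex q)) (u_fun _ _ _) => e p u /andP[].
lra.
Qed.

Lemma u_le_below_eq : u_fun lambda alpha beta <= pr (below_eq alpha beta).
Proof.
have beta0 := lt_le_trans alpha0 alpha_le_beta.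
have [C rate] := Ex_rate.
(* Exit on every grid from [N] on: these events increase with [N], and their union contains every
   strict excess of a level. *)
pose I N := \bigcap_(q in [set q | (N <= q)%N]) Ex q.
have mI N : measurable (I N).
  by apply: bigcap_measurable => [|q _]; [exists N => /=|exact: mEx].
have ndI : nondecreasing_seq I.
  move=> m n mn; rewrite subsetEset => w Iw q /= nq.
  by apply: Iw => /=; exact: leq_trans nq.
have PI N : (P (I N) <= (1 - u_fun lambda alpha beta)%:E)%E.
  (* The sign of [C] is unknown; its absolute value makes the bound decreasing in [q], as replacing
     [q] by [maxn N q] requires. *)
  rewrite prE// lee_fin; apply: (le_of_harmonic_error _ _ `|C|) => q.
  pose q' := maxn N q.
  have : pr (I N) <= pr (Ex q').
    by apply: pr_le => // w; apply; rewrite /= leq_maxl.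
  move/le_trans; apply; rewrite addrC -lerBlDr.
  apply: (le_trans (ler_norm _)); apply: (le_trans (rate q')).
  apply: (@le_trans _ _ (`|C| / q'.+1%:R)).
    by rewrite ler_pM2r ?invr_gt0 ?ltr0n// ler_norm.
  by rewrite ler_wpM2l// lef_pV2 ?posrE ?ltr0n// ler_nat ltnS leq_maxr.
have PU : (P (\bigcup_N I N) <= (1 - u_fun lambda alpha beta)%:E)%E.
  have mUI : measurable (\bigcup_N I N) by exact: bigcupT_measurable.
  have cv : P (I N) @[N --> \oo] --> P (\bigcup_N I N).
    exact: nondecreasing_cvg_mu.
  rewrite -(cvg_lim _ cv)//; apply: lime_le.
    by apply/cvg_ex; exists (P (\bigcup_N I N)).
  by apply: nearW => N; exact: PI.
have sub : ~` below_eq alpha beta `<=` \bigcup_N I N.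
  move=> w nbel.
  have ext : alpha < Dp w \/ beta < Dm w.
    by apply/orP; rewrite !ltNge -negb_and; apply/negP => /andP[h1 h2]; apply: nbel.
  have [N exN] := extremes_exits_before (fun t => X t w) (T w) alpha beta
    alpha0 beta0 (Xcont w) ext.
  by exists N => // q /= Nq; exact: exN.
have : pr (~` below_eq alpha beta) <= 1 - u_fun lambda alpha beta.
  rewrite -lee_fin -prE; last exact: measurableC.
  apply: le_trans PU; apply: le_measure => //; apply/mem_set.
    exact: measurableC.
  exact: bigcupT_measurable.
rewrite prC//; move: (pr _) (u_fun _ _ _) => p u; lra.
Qed.

End fixed_levels.

Section final_levels.
Variables alpha beta : R.
Hypotheses (alpha0 : 0 < alpha) (alpha_le_beta : alpha <= beta).

Let u := u_fun lambda alpha beta.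

Lemma u_le_below : u <= pr (below alpha beta).
Proof.
apply/ler_addgt0Pr => e e0.
have [dl [dl0 dla _ close]] := u_fun_shift lambda alpha beta e lambda0 alpha0 e0.
have al0 : 0 < alpha - dl by rewrite subr_gt0.
have ab : alpha - dl <= beta - dl by rewrite lerB.
have h1 := u_le_below_eq _ _ al0 ab.
have h2 : pr (below_eq (alpha - dl) (beta - dl)) <= pr (below alpha beta).
  apply: pr_le => // w [h h'].
  by split; [apply: (le_lt_trans h)|apply: (le_lt_trans h')]; rewrite ltrBlDr ltrDl.
move: close (le_trans h1 h2); rewrite -/u ltr_norml.
by move: (u_fun _ _ _) (pr _) u => x y z /andP[]; lra.
Qed.

Lemma below_eq_le_u : pr (below_eq alpha beta) <= u.
Proof.
apply/ler_addgt0Pr => e e0.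
have [dl [dl0 _ close _]] := u_fun_shift lambda alpha beta e lambda0 alpha0 e0.
have al0 : 0 < alpha + dl by rewrite addr_gt0.
have ab : alpha + dl <= beta + dl by rewrite lerD.
have h1 := below_le_u _ _ al0 ab.
have h2 : pr (below_eq alpha beta) <= pr (below (alpha + dl) (beta + dl)).
  apply: pr_le => // w [h h'].
  by split; [apply: (le_lt_trans h)|apply: (le_lt_trans h')]; rewrite ltrDl.
move: close (le_trans h2 h1); rewrite -/u ltr_norml.
by move: (u_fun _ _ _) (pr _) u => x y z /andP[]; lra.
Qed.

End final_levels.

Section final_probabilities.
Variables alpha beta : R.
Hypotheses (alpha0 : 0 < alpha) (alpha_le_beta : alpha <= beta).

Let u := u_fun lambda alpha beta.

Lemma probability_below :
  P [set w | max_increase (fun t => X t w) (T w) < alpha /\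
             max_decrease (fun t => X t w) (T w) < beta] =
  (u_fun lambda alpha beta)%:E.
Proof.
rewrite -/(below alpha beta) prE//; congr EFin; apply/eqP; rewrite eq_le.
by rewrite below_le_u// u_le_below.
Qed.

(** Removing [half] from [up] leaves exactly the event with decrease above [beta]; its probability
    is squeezed between those of [below] and [below_eq]. *)
Let half := [set w | Dp w < alpha /\ Dm w <= beta].

Let mhalf : measurable half.
Proof. by apply: measurableI; [exact: measurable_lt|exact: measurable_le]. Qed.

Let pr_half : pr half = u.
Proof.
apply/eqP; rewrite eq_le; apply/andP; split.
  apply: le_trans (below_eq_le_u _ _ alpha0 alpha_le_beta); apply: pr_le => // w [h h'].
  by split=> //; exact: ltW.
apply: (le_trans (u_le_below _ _ alpha0 alpha_le_beta)); apply: pr_le => // w [h h'].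
by split=> //; exact: ltW.
Qed.

Let up := [set w | Dp w < alpha].

Let mup : measurable up. Proof. exact: measurable_lt. Qed.

(** The second level is sent to infinity, where [v_fun] vanishes. *)
Let pr_up : pr up = 1 - (cosh (alpha * Num.sqrt (2 * lambda)))^-1.
Proof.
set c := _^-1; pose L n := below alpha (beta + n.+1%:R).
have ab n : alpha <= beta + n.+1%:R by rewrite (le_trans alpha_le_beta)// lerDl.
have mL n : measurable (L n) by exact: mbelow.
have upE : up = \bigcup_n L n.
  apply/seteqP; split=> [w wup|w [n _ []]//].
  exists (Num.truncn (Dm w - beta)) => //; split=> //.
  by rewrite addrC -ltrBlDr; exact: truncnS_gt.
have ndL : nondecreasing_seq L.
  move=> m n mn; rewrite subsetEset => w [h h']; split=> //.
  by apply: (lt_le_trans h'); rewrite lerD2l ler_nat.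
apply/eqP; rewrite eq_le; apply/andP; split.
  rewrite -lee_fin -prE// upE.
  have cv : P (L n) @[n --> \oo] --> P (\bigcup_n L n).
    by apply: nondecreasing_cvg_mu => //; exact: bigcupT_measurable.
  rewrite -(cvg_lim _ cv)//; apply: lime_le.
    by apply/cvg_ex; exists (P (\bigcup_n L n)).
  apply: nearW => n; rewrite prE// lee_fin.
  apply: (le_trans (below_le_u _ _ alpha0 (ab n))).
  by rewrite /u_fun -/c lerBlDr lerDl v_fun_ge0.
have [C decay] := v_fun_decay lambda alpha beta lambda0 alpha0 alpha_le_beta.
apply: (le_of_harmonic_error _ _ C) => q.
have h : pr (L q) <= pr up by apply: pr_le => // w [].
have := u_le_below _ _ alpha0 (ab q); have := decay q.
rewrite /u_fun -/c; move: h; rewrite /L.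
move: (pr _) (pr _) (v_fun _ _ _) (C / _) c => p p' v e c'; lra.
Qed.

Lemma probability_below_above :
  P [set w | max_increase (fun t => X t w) (T w) < alpha /\
             max_decrease (fun t => X t w) (T w) > beta] =
  (v_fun lambda alpha beta)%:E.
Proof.
set A := [set w | _].
have AE : A = up `\` half.
  apply/seteqP; split=> [w [h h']|w [h h']].
    by split=> // -[_]; rewrite leNgt h'.
  by split=> //; rewrite ltNge; apply/negP => h''; apply: h'.
have hu : half `<=` up by move=> w [].
have PA : P A = (P up - P half)%E.
  rewrite AE -[in RHS](setIidr hu) measureD//.
  by rewrite (le_lt_trans (probability_le1 _ _))// ltry.
rewrite PA !prE// pr_up pr_half -EFinB; congr EFin.
by rewrite /u /u_fun; ring.
Qed.

End final_probabilities.

End brownian_core.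

(** * Transfer to Brownian motion and its opposite *)

Lemma mutually_independent_opp {d} {Omega : measurableType d} {R : realType}
    (P : probability Omega R) n (Y : 'I_n -> Omega -> R) :
  mutually_independent P Y -> mutually_independent P (fun i w => - Y i w).
Proof.
move=> indep B mB.
have mNB i : measurable (-%R @^-1` B i).
  have mN : measurable_fun setT (-%R : R -> R) by [].
  by rewrite -[X in measurable X]setTI; exact: mN.
exact: (indep (fun i => -%R @^-1` B i)).
Qed.

Lemma gaussian_increment_mgf {d} {Omega : measurableType d} {R : realType}
    (P : probability Omega R) (Z : Omega -> R) (h c : R) :
  0 < h -> measurable_fun setT Z ->
  (forall B, measurable B -> pushforward P Z B = normal_prob 0 (Num.sqrt h) B) ->
  (\int[P]_w (expR (c * Z w))%:E = (expR (c ^+ 2 * h / 2))%:E)%E.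
Proof.
move=> h0 mZ ZN; have sh0 : Num.sqrt h != 0 by rewrite gt_eqF// sqrtr_gt0.
have mZ' : measurable_fun setT (Z : Omega -> measurableTypeR R) by [].
pose Z' : {RV P >-> measurableTypeR R} :=
  HB.pack (Z : Omega -> measurableTypeR R) (isMeasurableFun.Build _ _ _ _ _ mZ').
have := normal_mgf (distribution P Z') c _ sh0 ZN.
rewrite sqr_sqrtr ?(ltW h0)// => <-.
rewrite ge0_integral_distribution//.
apply/measurable_EFinP; apply: measurableT_comp => //; exact: measurable_funM.
Qed.

(* The printed formula P(D+ > alpha, D- < beta) = v(min, max) is false when
   alpha < beta: for fixed beta and alpha -> 0 its left side tends to
   1 - 1 / cosh(beta sqrt(2 lambda)) > 0 and its right side to 0. It is stated
   here for beta <= alpha, and for alpha <= beta with the event obtained by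
   exchanging the roles of D+ and D-. *)
Theorem proposition4p5 (R : realType) (d : measure_display)
    (Omega : measurableType d) (P : probability Omega R)
    (x : R) (X : R -> {RV P >-> R}) (lambda : R) (T : {RV P >-> R})
    (hX : standard_brownian_motion x X)
    (hlambda : 0 < lambda)
    (hT : forall B : set R, measurable B ->
       distribution P T B = exponential_prob lambda B)
    (hXT : independent_of_process T X) :
  let Dp := fun w : Omega => max_increase (fun t : R => X t w) (T w) in
  let Dm := fun w : Omega => max_decrease (fun t : R => X t w) (T w) in
  forall alpha beta : R, 0 < alpha -> 0 < beta ->
    [/\ alpha <= beta ->
          P [set w | Dp w < alpha /\ Dm w < beta]
            = (u_fun lambda alpha beta)%:E,
        beta <= alpha ->
          P [set w | Dp w < alpha /\ Dm w < beta]
            = (u_fun lambda beta alpha)%:E,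
        beta <= alpha ->
          P [set w | Dp w > alpha /\ Dm w < beta]
            = (v_fun lambda (Num.min alpha beta) (Num.max alpha beta))%:E
      & alpha <= beta ->
          P [set w | Dp w < alpha /\ Dm w > beta]
            = (v_fun lambda (Num.min alpha beta) (Num.max alpha beta))%:E].
Proof.
move=> Dp Dm alpha beta alpha0 beta0.
pose G : set (set Omega) := \bigcup_(t in `[0, +oo[)
  preimage_set_system setT (X t) measurable.
(* The general results are applied to [X] and to [- X] with the same [G]; the latter exchanges [Dp]
   and [Dm] and so yields the cases [beta <= alpha]. *)
pose XN t w := - X t w.
have mX t : measurable_fun setT (X t) by exact: measurable_funP.
have mT : measurable_fun setT T by exact: measurable_funP.
have sGm : <<s G >> `<=` measurable.
  apply: smallest_sub; first exact: sigma_algebra_measurable.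
  by move=> _ [t _ [B mB <-]]; exact: mX.
have mXG t : 0 <= t -> measurable_fun setT (X t : g_sigma_algebraType G -> R).
  move=> t0 _ B mB; apply: sub_sigma_algebra; exists t; last by exists B.
  by rewrite /= in_itv/= t0.
have mXNG t : 0 <= t -> measurable_fun setT (XN t : g_sigma_algebraType G -> R).
  by move=> t0; apply: measurableT_comp => //; exact: mXG.
have T_exp A t : <<s G >> A -> 0 <= t ->
    P ([set w | t <= T w] `&` A) = ((expR (- (lambda * t)))%:E * P A)%E.
  move=> GA t0; have TE : [set w | t <= T w] = T @^-1` `[t, +oo[%classic.
    by apply/seteqP; split=> w /=; rewrite in_itv/= andbT.
  have Tsys : preimage_set_system setT T measurable (T @^-1` `[t, +oo[%classic).
    by exists `[t, +oo[%classic; [exact: measurable_itv|rewrite setTI].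
  rewrite TE (hXT _ _ Tsys GA) -exponential_prob_itvcy//.
  by rewrite -hT//; exact: measurable_itv.
have Xcont w : {within `[0, +oo[, continuous (fun t => X t w)}.
  exact: (brownian_continuous hX).
have XNcont w : {within `[0, +oo[, continuous (fun t => XN t w)}.
  by move=> t; apply: cvgN; exact: Xcont.
have indep q n : mutually_independent P (fun (i : 'I_n) w =>
    grid_increment (fun t => X t w) q i).
  have g0 := ltW (grid_step_gt0 q : 0 < grid_step q :> R).
  pose t k : R := k%:R * grid_step q.
  have t0 : 0 <= t 0%N by rewrite /t mul0r.
  have tmono : {homo t : i j / (i <= j)%N >-> i <= j}.
    by move=> i j ij; rewrite /t ler_wpM2r// ler_nat.
  have := @brownian_independent _ _ _ _ _ _ hX n t t0 tmono; exact.
have mgf q k c : (\int[P]_w (expR (c * grid_increment (fun t => X t w) q k))%:E =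
    (expR (c ^+ 2 * grid_step q / 2))%:E)%E.
  have g0 := grid_step_gt0 q : 0 < grid_step q :> R.
  apply: gaussian_increment_mgf => //.
    by apply: measurable_funB.
  move=> B mB.
  have kh : 0 <= k%:R * (grid_step q : R) := mulr_ge0 (ler0n _ _) (ltW g0).
  have kk : k%:R * (grid_step q : R) < k.+1%:R * grid_step q.
    by rewrite ltr_pM2r// ltr_nat.
  have stepE : k.+1%:R * grid_step q - k%:R * grid_step q = grid_step q :> R.
    by rewrite -mulrBl mulrSr addrAC subrr add0r mul1r.
  have := brownian_gaussian hX kh kk mB; rewrite stepE; exact.
have gridN q k w : grid_increment (fun t => XN t w) q k =
    - grid_increment (fun t => X t w) q k.
  by rewrite /grid_increment /XN; ring.
have indepN q n : mutually_independent P (fun (i : 'I_n) w =>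
    grid_increment (fun t => XN t w) q i).
  have -> : (fun (i : 'I_n) w => grid_increment (fun t => XN t w) q i) =
      fun (i : 'I_n) w => - grid_increment (fun t => X t w) q i.
    by apply/funext => i; apply/funext => w; exact: gridN.
  exact: mutually_independent_opp.
have mgfN q k c : (\int[P]_w (expR (c * grid_increment (fun t => XN t w) q k))%:E =
    (expR (c ^+ 2 * grid_step q / 2))%:E)%E.
  under eq_integral do rewrite gridN mulrN -mulNr.
  by rewrite mgf sqrrN.
have XN_up w : max_increase (fun t => XN t w) (T w) = Dm w.
  by rewrite /Dm max_decreaseE.
have XN_down w : max_decrease (fun t => XN t w) (T w) = Dp w.
  rewrite max_decreaseE /Dp; congr max_increase.
  by apply/funext => t; rewrite /XN opprK.
split=> [ab|ba|ba|ab].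
- exact: (probability_below P G X T lambda hlambda sGm mXG mT T_exp Xcont indep mgf).
- rewrite -(probability_below P G XN T lambda hlambda sGm mXNG mT T_exp XNcont
    indepN mgfN beta alpha beta0 ba); congr (P _).
  by apply/seteqP; split=> w /=; rewrite XN_up XN_down => -[].
- rewrite (min_r ba) (max_l ba) -(probability_below_above P G XN T lambda hlambda
    sGm mXNG mT T_exp XNcont indepN mgfN beta alpha beta0 ba); congr (P _).
  by apply/seteqP; split=> w /=; rewrite XN_up XN_down => -[].
- rewrite (min_l ab) (max_r ab).
  exact: (probability_below_above P G X T lambda hlambda sGm mXG mT T_exp Xcont
    indep mgf).
Qed.
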